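(* Let $X_1,\ldots,X_n$ be independent random variables with values in a measurable space $(\mathscr X,\mathcal X)$ and let $\mathscr F$ be an at most countable class of functions on $\mathscr X$ with values in $[-1,1]$ which is VC-subgraph with dimension not larger than $V\ge1$. Let $$Z(\mathscr F)=\sup_{f\in\mathscr F}\Big|\sum_{i=1}^n\big(f(X_i)-\mathbb E[f(X_i)]\big)\Big|$$ and let $\sigma\in(0,1]$ satisfy $\sup_{f\in\mathscr F}\frac1n\sum_{i=1}^n\mathbb E[f^2(X_i)]\le\sigma^2$. Then $$\mathbb E[Z(\mathscr F)]\le 4.74\sqrt{nV\sigma^2\mathcal L(\sigma)}+90V\mathcal L(\sigma),\qquad\mathcal L(\sigma)=9.11+\log(1/\sigma^2).$$
   Context: A class of real functions on $\mathscr X$ is VC-subgraph with dimension not larger than $V$ if the family of subgraphs $\{(x,t)\in\mathscr X\times\mathbb R:\ f(x)>t\}$, $f$ in the class, shatters no finite subset of $\mathscr X\times\mathbb R$ of cardinality larger than $V$. *)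

(* Defs.v *)
From HB Require Import structures.
From mathcomp Require Import all_boot all_order all_algebra.
From mathcomp Require Import all_classical all_reals all_analysis.
Set Implicit Arguments. Unset Strict Implicit. Unset Printing Implicit Defensive.
Import Order.TTheory GRing.Theory Num.Theory.
Local Open Scope classical_set_scope.
Local Open Scope ring_scope.

Definition mutually_independent {d d' : measure_display} {T : measurableType d}
  {Xs : measurableType d'} {R : realType} (P : probability T R) (n : nat)
  (X : 'I_n -> T -> Xs) : Prop :=
  forall B : 'I_n -> set Xs, (forall i, measurable (B i)) ->
    P (\bigcap_(i in [set: 'I_n]) (X i @^-1` B i)) = (\prod_(i < n) P (X i @^-1` B i))%E.

(* F shatters the finite set of points listed (without repetition) in s:
   every subset A of s is cut out by the subgraph {(x,t) | f x > t} of some f in F. *)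
Definition shatters {Xs : eqType} {R : realType} (F : set (Xs -> R)) (s : seq (Xs * R)) : Prop :=
  forall A : set (Xs * R), exists2 f, F f &
    forall p : Xs * R, p \in s -> (p.2 < f p.1 <-> A p).

Definition VC_subgraph_dim_le {Xs : eqType} {R : realType} (F : set (Xs -> R)) (V : R) : Prop :=
  forall s : seq (Xs * R), uniq s -> V < (size s)%:R -> ~ shatters F s.

Definition Ereal {d} {T : measurableType d} {R : realType} (P : probability T R)
  (Y : T -> R) : R := fine (\int[P]_w (Y w)%:E)%E.

Definition Zsup {d d' : measure_display} {T : measurableType d}
  {Xs : measurableType d'} {R : realType} (P : probability T R) (n : nat)
  (X : 'I_n -> T -> Xs) (F : set (Xs -> R)) (w : T) : \bar R :=
  ereal_sup [set (`| \sum_(i < n) (f (X i w) - Ereal P (f \o X i)) |)%:E | f in F].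

Definition Lsig {R : realType} (sigma : R) : R := 911 / 100 + ln (1 / sigma ^+ 2).

(* Main.v *)
Require Import Defs.
From HB Require Import structures.
From mathcomp Require Import all_boot all_order all_algebra.
From mathcomp Require Import all_classical all_reals all_analysis.
From mathcomp Require Import measurable_realfun ring lra.
Import Order.TTheory GRing.Theory Num.Theory numFieldNormedType.Exports.
Local Open Scope classical_set_scope.
Local Open Scope ring_scope.

(* Symmetrization bounds E Z by twice a Rademacher average, which conditionally
   on the sample is controlled by chaining.  The metric entropy of the class in
   the empirical L2 norm comes from the Sauer-Shelah lemma and Dudley's argument:
   if N functions are eps-separated, about (log N) / eps^2 well-chosen points of
   the sample times the line separate their subgraphs, so that N is bounded by
   the growth function at that number of points; this gives
   log N <= (3/2) V log (36 / eps^2).  Chaining along nets of radii s, s/4,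
   s/16, ..., where s^2 is the largest empirical second moment, yields a bound
   2.37 sqrt (n V s^2 (8.5 + log (1/s^2))), and linearising the logarithm at
   sigma^2 makes it the square root of an affine function of s^2, to which Jensen
   applies.  Finally E s^2 - sigma^2 is at most the expected supremum of the
   process of the f^2 divided by n; as f^2/2 is a 1-Lipschitz image of f, the
   same chaining bound applies to it, and solving the resulting quadratic
   inequality gives the constants 4.74 and 2 * 4.74^2 <= 90. *)

(** * Shattering, the Sauer-Shelah lemma and the growth function *)

Section VapnikChervonenkis.
Variables (J : finType) (pt : eqType) (M : J -> pt -> bool).

Definition trace_injective (B : {set J}) (s : seq pt) :=
  {in B &, forall j j', (forall p, p \in s -> M j p = M j' p) -> j = j'}.

Definition trace_full (B : {set J}) (s : seq pt) :=
  forall A : pt -> bool, exists2 j, j \in B &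
    forall p, p \in s -> M j p = A p.

Lemma trace_full0 (B : {set J}) j : j \in B -> trace_full B [::].
Proof. by move=> jB A; exists j. Qed.

Lemma trace_fullS (B C : {set J}) s :
  B \subset C -> trace_full B s -> trace_full C s.
Proof.
by move=> /fintype.subsetP BC Bs A; have [j /BC jC jA] := Bs A; exists j.
Qed.

Lemma sum_binS k m : (\sum_(i < k.+1) 'C(m.+1, i) =
  \sum_(i < k.+1) 'C(m, i) + \sum_(i < k) 'C(m, i))%N.
Proof.
rewrite big_ord_recl bin0 [in RHS]big_ord_recl bin0 -addnA; congr (_ + _)%N.
by rewrite -big_split; apply: eq_bigr => i _; rewrite /= /bump add1n binS.
Qed.

(* Split off the first point [p] of [s]: the elements of [B] that contain [p]
   and have a twin in [B] differing from them at [p] only form a class of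
   smaller dimension. *)
Lemma sauer_shelah k s (B : {set J}) :
  trace_injective B s ->
  (forall S, subseq S s -> size S = k -> ~ trace_full B S) ->
  (#|B| <= \sum_(i < k) 'C(size s, i))%N.
Proof.
elim: s k B => [|p s IH] k B Binj Bk.
  have B1 : (#|B| <= 1)%N.
    by apply/card_le1_eqP => j j' jB j'B; apply: Binj.
  case: k Bk => [|k] Bk; last by rewrite big_ord_recl bin0 (leq_trans B1).
  rewrite big_ord0 leqn0 cards_eq0; apply/eqP/setP => j; rewrite inE.
  by apply/negP => jB; apply: (Bk [::]) => //; exact: trace_full0 jB.
pose C := [set j in B | M j p &&
  [exists j' in B, ~~ M j' p && all (fun q => M j q == M j' q) s]].
have CB : C \subset B by apply/fintype.subsetP => j; rewrite inE => /andP[].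
(* Of two elements of [B] that agree on [s] but not at [p], the one containing [p] has a twin, so it
   lies in [C]. *)
have BCinj : trace_injective (B :\: C) s.
  move=> j j'; rewrite !finset.in_setD => /andP[jC jB] /andP[j'C j'B] jj'.
  apply: Binj => // q; rewrite inE => /predU1P[->|/jj' //].
  case: (boolP (M j p)) (boolP (M j' p)) => [jp|jp] [j'p|j'p] //.
    case/negP: jC; rewrite inE jB jp; apply/existsP; exists j'.
    by rewrite j'B j'p; apply/allP => r /jj' ->.
  case/negP: j'C; rewrite inE j'B j'p; apply/existsP; exists j.
  by rewrite jB jp; apply/allP => r /jj' ->.
have Cinj : trace_injective C s.
  move=> j j'; rewrite !inE => /and3P[jB jp _] /and3P[j'B j'p _] jj'.
  by apply: Binj => // q; rewrite inE => /predU1P[->|/jj' //]; rewrite jp j'p.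
have leBC : (#|B :\: C| <= \sum_(i < k) 'C(size s, i))%N.
  apply: IH => // S Ss Sk /(trace_fullS _ _ _ (subsetDl _ _)).
  by apply: Bk => //; rewrite (subseq_trans Ss)// subseq_cons.
rewrite -(cardsID C B) (finset.setIidPr CB) addnC.
case: k Bk leBC => [|k] Bk leBC.
  suff -> : #|C| = 0%N by move: leBC; rewrite addn0 !big_ord0.
  apply/eqP; rewrite cards_eq0; apply/eqP/setP => j.
  rewrite finset.in_set0; apply/negP => /(fintype.subsetP CB) jB.
  by apply: (Bk [::]) => //; exact: trace_full0 jB.
rewrite sum_binS leq_add //; apply: IH => // S Ss Sk CS.
(* If [C] shatters [S] then [B] shatters [p :: S]: elements of [C] cut out the subsets with [p],
   their twins those without. *)
apply: (Bk (p :: S)); rewrite /= ?eqxx ?Sk // => A.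
have [j + jA] := CS A; rewrite inE => /and3P[jB jp].
move=> /existsP[j' /and3P[j'B j'p /allP jj']].
case: (boolP (A p)) => Ap.
  by exists j => // q; rewrite inE => /predU1P[->|/jA //]; rewrite jp Ap.
exists j' => // q; rewrite inE => /predU1P[->|qS].
  by rewrite (negbTE Ap) (negbTE j'p).
by rewrite -jA // (eqP (jj' q (mem_subseq Ss qS))).
Qed.

End VapnikChervonenkis.

Lemma sum_expr_bin_le (R : realType) (m d : nat) (y : R) : 0 <= y ->
  \sum_(i < d) y ^+ i *+ 'C(m, i) <= (1 + y) ^+ m.
Proof.
move=> y0; rewrite addrC exprD1n.
rewrite -!(big_mkord xpredT (fun i => y ^+ i *+ 'C(m, i))).
have [dm|/ltnW dm] := leqP d m.+1.
  rewrite [leRHS](big_cat_nat (n := d)) //= lerDl sumr_ge0 // => i _.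
  by rewrite mulrn_wge0 ?exprn_ge0.
rewrite [leLHS](big_cat_nat (n := m.+1)) //= gerDl big_nat big1 // => i.
by case/andP=> mi _; rewrite bin_small.
Qed.

(** Each binomial coefficient is multiplied by [(mu / d) ^ (d - i) >= 1]; the binomial formula then
    gives [(mu / d) ^ d * (1 + d / mu) ^ m], whose last factor is at most [expR d] as [m <= mu].
    Allowing [mu] above [m] covers the case [m < d]. *)
Lemma sum_bin_le (R : realType) (m d : nat) (mu : R) :
  (0 < d)%N -> m%:R <= mu -> d%:R <= mu ->
  (\sum_(i < d.+1) 'C(m, i))%:R <= expR (d%:R * (1 + ln (mu / d%:R))) :> R.
Proof.
move=> d0 mmu dmu; have d0R : 0 < d%:R :> R by rewrite ltr0n.
have mu0 : 0 < mu by exact: lt_le_trans dmu.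
set r := mu / d%:R; have r1 : 1 <= r by rewrite ler_pdivlMr // mul1r.
have r0 : 0 < r by exact: lt_le_trans r1.
rewrite mulrDr mulr1 expRD mulrC -[d%:R * ln r]mulrC expRM_natr lnK //.
rewrite -ler_pdivrMl ?exprn_gt0 // natr_sum mulr_sumr.
have rV i : (i <= d)%N -> (r ^+ d)^-1 <= (r^-1) ^+ i.
  by move=> id; rewrite exprVn lef_pV2 ?posrE ?exprn_gt0 // ler_weXn2l.
apply: (@le_trans _ _ (\sum_(i < d.+1) r^-1 ^+ i *+ 'C(m, i))).
  by apply: ler_sum => i _; rewrite -[leRHS]mulr_natr ler_wpM2r ?rV // -ltnS.
apply: (le_trans (sum_expr_bin_le R _ _ _ _)); first by rewrite invr_ge0 ltW.
apply: (@le_trans _ _ (expR (r^-1 * m%:R))).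
  by rewrite expRM_natr lerXn2r ?nnegrE ?expR_ge0 ?expR_ge1Dx ?addr_ge0
    ?invr_ge0 // ltW.
rewrite ler_expR /r invf_div mulrAC ler_pdivrMr // ler_pM2l //.
Qed.

(** * Separating points and empirical metric entropy *)

(** The levels [t] at which exactly one of [t < a p] and [t < b p] holds fill an interval inside
    [[-1, 1]], as long as the distance from [a p] to [b p]. If all counts were below [c],
    integrating them over [[-1, 1]], of length 2, would contradict the hypothesis. *)
Lemma exists_crossed_level (R : realType) (I : finType) (Q : {set I})
    (a b : I -> R) (c : R) :
  (forall p, -1 <= a p <= 1) -> (forall p, -1 <= b p <= 1) ->
  2 * c < \sum_(p in Q) `|a p - b p| ->
  exists t, c <= #|[set p in Q | (t < a p) != (t < b p)]|%:R.
Proof.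
move=> a1 b1; apply: contraPP => /forallNP tc; apply/negP; rewrite -leNgt.
have {}tc t : #|[set p in Q | (t < a p) != (t < b p)]|%:R <= c.
  by apply/ltW; rewrite ltNge; apply/negP/tc.
(* Open on the right because the comparison [t < a p] is strict. *)
pose A p : set R := `[Num.min (a p) (b p), Num.max (a p) (b p)[%classic.
have AE p t : \1_(A p) t = ((t < a p) != (t < b p))%:R :> R.
  rewrite indicE /A mem_setE in_itv /= ge_min lt_max !(leNgt _ t).
  by case: (t < a p); case: (t < b p).
have lenA p : `|a p - b p|%:E =
    (\int[lebesgue_measure]_(t in `[(-1)%R, 1%R]) (\1_(A p) t)%:E)%E.
  have mA : measurable (A p) by exact: measurable_itv.
  rewrite integral_indic // (_ : A p `&` _ = A p); last first.
    apply/classical_sets.setIidPl => t; rewrite /A /= !in_itv /= => /andP[mt tM].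
    have /andP[a1p a2p] := a1 p; have /andP[b1p b2p] := b1 p.
    by rewrite (le_trans _ mt) ?le_min ?a1p ?b1p // (le_trans (ltW tM)) //
      ge_max a2p b2p.
  rewrite /A /= lebesgue_measure_itv /= lte_fin.
  by have [ab|ba|ab] := ltrgtP (a p) (b p); rewrite ?ab ?ba ?ltxx.
rewrite -lee_fin -sumEFin (eq_bigr _ (fun p _ => lenA p)).
rewrite big_mkcond /=.
have -> : (2 * c)%:E =
    (\int[lebesgue_measure]_(t in `[(-1)%R, 1%R]) c%:E)%E.
  rewrite integral_cst //= lebesgue_measure_itv /= lte_fin.
  by rewrite (_ : (-1 < 1 :> R) = true) -?EFinD -?EFinM ?opprK 1?mulrC //; lra.
have mA p D : measurable_fun D (fun t : measurableTypeR R => (\1_(A p) t)%:E).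
  by apply/measurable_EFinP/measurable_indic; exact: measurable_itv.
rewrite -big_mkcond -big_enum /= -ge0_integral_sum //.
apply: ge0_le_integral => //.
- by move=> t _; apply: sume_ge0 => p _; rewrite lee_fin.
- exact: emeasurable_sum.
- move=> t _; rewrite sumEFin lee_fin big_enum_cond /= (le_trans _ (tc t)) //.
  rewrite -sum1_card natr_sum big_mkcond [leRHS]big_mkcond /=.
  apply: ler_sum => p _; rewrite inE AE.
  by case: (p \in Q) => //; case: (_ != _).
Qed.

Section EmpiricalEntropy.
Variables (R : realType) (J : finType) (n : nat) (u : J -> 'I_n -> R).
Hypothesis n0 : (0 < n)%N.
Hypothesis u1 : forall j i, -1 <= u j i <= 1.

Definition above (j : J) (q : 'I_n * R) : bool := q.2 < u j q.1.

(** Two averagings: some coordinate [i] carries its share of the total absolute distance, and on it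
    some level separates enough pairs. The factor 2 is the length of the range [[-1, 1]] of
    levels. *)
Lemma exists_separating_point (Q : {set J * J}) (delta : R) :
  (forall p, p \in Q ->
    2 * (n%:R * delta) < \sum_(i < n) `|u p.1 i - u p.2 i|) ->
  exists q, delta * #|Q|%:R <= #|[set p in Q | above p.1 q != above p.2 q]|%:R.
Proof.
move=> sepQ; have [->|/set0Pn[p0 p0Q]] := eqVneq Q finset.set0.
  exists (Ordinal n0, 0); rewrite cards0 mulr0; exact: ler0n.
suff [i Hi] : exists i, 2 * (delta * #|Q|%:R) <
    \sum_(p in Q) `|u p.1 i - u p.2 i|.
  have [t Ht] := exists_crossed_level R _ Q (fun p => u p.1 i) (fun p => u p.2 i)
    (delta * #|Q|%:R) (fun p => u1 p.1 i) (fun p => u1 p.2 i) Hi.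
  by exists (i, t).
apply: contrapT => /forallNP Hi.
suff : \sum_(p in Q) \sum_(i < n) `|u p.1 i - u p.2 i| <=
    \sum_(p in Q) (2 * (n%:R * delta)).
  apply/negP; rewrite -ltNge (bigD1 p0) //= [ltRHS](bigD1 p0) //=.
  rewrite ltr_leD ?sepQ //; apply: ler_sum => p /andP[pQ _].
  by rewrite ltW // sepQ.
rewrite exchange_big sumr_const /=.
have -> : 2 * (n%:R * delta) *+ #|Q| = \sum_(i < n) (2 * (delta * #|Q|%:R)).
  by rewrite sumr_const card_ord -mulr_natr -[RHS]mulr_natr; ring.
by apply: ler_sum => i _; rewrite leNgt; apply/negP/Hi.
Qed.

(* Each new point is chosen greedily so as to separate a proportion [delta] of
   the pairs that are still unseparated. *)
Lemma exists_separating_seq (Q : {set J * J}) (delta : R) (m : nat) :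
  delta <= 1 ->
  (forall p, p \in Q ->
    2 * (n%:R * delta) < \sum_(i < n) `|u p.1 i - u p.2 i|) ->
  exists2 s, size s = m &
    #|[set p in Q | all (fun q => above p.1 q == above p.2 q) s]|%:R <=
      (1 - delta) ^+ m * #|Q|%:R :> R.
Proof.
move=> delta1 sepQ; elim: m => [|m [s sm IH]].
  exists [::] => //; rewrite expr0 mul1r ler_nat subset_leq_card //.
  by apply/fintype.subsetP => p; rewrite inE => /andP[].
set Q' := [set p in Q | _] in IH.
have [q Hq] : exists q, delta * #|Q'|%:R <=
    #|[set p in Q' | above p.1 q != above p.2 q]|%:R.
  by apply: exists_separating_point => p; rewrite inE => /andP[/sepQ].
exists (q :: s); rewrite /= ?sm // exprS -mulrA.
apply: le_trans (ler_wpM2l _ IH); last by rewrite subr_ge0.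
have -> : [set p in Q | (above p.1 q == above p.2 q) &&
    all (fun r => above p.1 r == above p.2 r) s] =
    Q' :\: [set p in Q' | above p.1 q != above p.2 q].
  apply/setP => p; rewrite !inE; case: (p \in Q) => //=.
  by case: (_ == _); case: (all _ _).
rewrite cardsD (finset.setIidPr _) ?natrB; last first.
- by apply/fintype.subsetP => p; rewrite inE => /andP[].
- by rewrite subset_leq_card //; apply/fintype.subsetP => p; rewrite inE => /andP[].
by rewrite mulrBl mul1r lerD2l lerN2.
Qed.

End EmpiricalEntropy.

Lemma ln_le_subr1 (R : realType) (x : R) : 0 < x -> ln x <= x - 1.
Proof. by move=> x0; rewrite -[in leLHS](subrKC 1 x) le_ln1Dx //; lra. Qed.

Section MetricEntropy.
Variables (R : realType) (J : finType) (n : nat) (u : J -> 'I_n -> R) (V : R).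
Hypothesis n0 : (0 < n)%N.
Hypothesis u1 : forall j i, -1 <= u j i <= 1.
Hypothesis V1 : 1 <= V.
Hypothesis uV : forall S : seq ('I_n * R), uniq S -> V < (size S)%:R ->
  ~ trace_full J _ (above R J n u) [set: J] S.

(** The Sauer-Shelah lemma applies with [k] one more than the integer part of [V], the least size
    that exceeds [V]. *)
Lemma card_trace_injective_le (B : {set J}) (s : seq ('I_n * R)) (mu : R) :
  (0 < #|B|)%N -> trace_injective J _ (above R J n u) B s ->
  (size s)%:R <= mu -> (Num.truncn V)%:R <= mu ->
  ln #|B|%:R <= (Num.truncn V)%:R * (1 + ln (mu / (Num.truncn V)%:R)).
Proof.
move=> B0 Bs smu Vmu; have /andP[dV Vd] := truncn_itv (le_trans ler01 V1).
have d0 : (0 < Num.truncn V)%N by rewrite truncn_gt0.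
rewrite -ler_expR lnK ?posrE ?ltr0n //.
(* Repetitions are removed because [uV] speaks of duplicate-free sequences; injectivity of traces is
   preserved. *)
apply: le_trans (sum_bin_le _ (size (undup s)) _ _ d0 _ Vmu); last first.
  by rewrite (le_trans _ smu) // ler_nat size_undup.
rewrite ler_nat; apply: (sauer_shelah _ _ (above R J n u)).
  by move=> j j' jB j'B jj'; apply: Bs => // p ps; rewrite jj' // mem_undup.
move=> S Ss Sd BS; apply: (uV S); first exact: subseq_uniq Ss (undup_uniq s).
  by rewrite Sd.
by apply: trace_fullS BS; exact: finset.subsetT.
Qed.

(** After [m] greedy points at most [(1 - delta) ^ m * N ^ 2 <= expR (2 * ln N - delta * m)] ordered
    pairs are unseparated, which is below 1 once [m > 2 * ln N / delta]. *)
Lemma exists_separating_short_seq (B : {set J}) (delta : R) :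
  (1 < #|B|)%N -> 0 < delta <= 1 / 4 ->
  {in B &, forall j j', j != j' ->
    2 * (n%:R * delta) < \sum_(i < n) `|u j i - u j' i|} ->
  exists2 s, trace_injective J _ (above R J n u) B s &
    (size s)%:R <= 3 * ln #|B|%:R / delta.
Proof.
move=> B1 /andP[delta0 delta4] sepB; set N : R := #|B|%:R.
have N2 : 2 <= N by rewrite ler_nat.
have N0 : 0 < N by lra.
have lnN : 1 / 2 <= ln N.
  have := ln_le_subr1 R N^-1; rewrite invr_gt0 N0 lnV // => /(_ isT).
  have : N^-1 <= 2^-1 by rewrite lef_pV2 ?posrE; lra.
  by lra.
pose r := 2 * ln N / delta; have r0 : 0 <= r by rewrite divr_ge0; lra.
have /andP[mr rm] := truncn_itv r0; set m := (Num.truncn r).+1 in rm.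
pose Q := [set p in finset.setX B B | p.1 != p.2].
have [||s sm Hs] := exists_separating_seq R J n u n0 u1 Q delta m.
- by lra.
- by move=> [j j']; rewrite !inE /= => /andP[/andP[]]; exact: sepB.
have QN : #|Q|%:R <= N ^+ 2.
  rewrite -natrX ler_nat -mulnn -cardsX subset_leq_card //.
  by apply/fintype.subsetP => p; rewrite inE => /andP[].
have {Hs} /eqP : #|[set p in Q | all (fun q =>
    above R J n u p.1 q == above R J n u p.2 q) s]| == 0%N.
  rewrite -leqn0 -ltnS -(ltr_nat R) (le_lt_trans Hs) //.
  apply: (@le_lt_trans _ _ (expR (- delta * m%:R) * N ^+ 2)).
    have d1 : 0 <= 1 - delta by lra.
    apply: ler_pM; rewrite ?exprn_ge0 ?ler0n // expRM_natr.
    by rewrite lerXn2r ?nnegrE ?expR_ge0 ?expR_ge1Dx.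
  rewrite -[N]lnK ?posrE // -expRM_natr -expRD expR_lt1.
  by move: rm; rewrite ltr_pdivrMr //; lra.
move/cards0_eq => Q0; exists s.
  move=> j j' jB j'B jj'; apply/eqP; apply: contrapT => /negP jNj'.
  have : (j, j') \in finset.set0.
    by rewrite -Q0 !inE /= jB j'B jNj'; apply/allP => q /jj' ->.
  by rewrite inE.
(* Rounding up costs at most 1, and [1 <= ln N / delta] since [ln N >= 1 / 2] and [delta <= 1 / 4];
   the factor 2 becomes 3. *)
rewrite sm /m -natr1; apply: le_trans (lerD mr _ : _ <= r + ln N / delta) _.
  by rewrite ler_pdivlMr //; lra.
by rewrite /r -mulrDl ler_pM2r ?invr_gt0 //; lra.
Qed.

(** The growth bound at about [3 * ln N / delta] separating points is an implicit inequality for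
    [ln N], which [ln x <= x - 1] makes explicit. *)
Lemma entropy_bound (B : {set J}) (eps : R) :
  (0 < #|B|)%N -> 0 < eps <= 1 ->
  {in B &, forall j j', j != j' ->
    n%:R * eps ^+ 2 < \sum_(i < n) (u j i - u j' i) ^+ 2} ->
  ln #|B|%:R <= 3 / 2 * (V * ln (36 / eps ^+ 2)).
Proof.
move=> B0 /andP[eps0 eps1] sepB.
have V0 : 0 <= V := le_trans ler01 V1.
have e2 : 0 < eps ^+ 2 <= 1 by rewrite exprn_gt0 //= expr_le1 // ltW.
have E36 : 36 <= 36 / eps ^+ 2 by rewrite ler_pdivlMr; lra.
have lnE : 2 / 3 <= ln (36 / eps ^+ 2).
  have K0 : 0 < 36 / eps ^+ 2 by lra.
  have := ln_le_subr1 R (36 / eps ^+ 2)^-1.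
  rewrite invr_gt0 K0 lnV ?posrE // => /(_ isT).
  have : (36 / eps ^+ 2)^-1 <= 36^-1 by rewrite lef_pV2 ?posrE; lra.
  by lra.
have [B1|B1] := leqP #|B| 1.
  have -> : #|B| = 1%N by apply/eqP; rewrite eqn_leq B1.
  have : 0 <= V * ln (36 / eps ^+ 2) by apply: mulr_ge0; lra.
  by rewrite ln1; lra.
(* Values in [[-1, 1]] make squared differences at most twice the absolute ones, so this [delta]
   meets the separation condition [2 * (n * delta)]. *)
pose delta := eps ^+ 2 / 4.
have [||s Bs ss] := exists_separating_short_seq B delta B1.
- by rewrite /delta; lra.
- move=> j j' jB j'B /(sepB _ _ jB j'B) H.
  suff : \sum_(i < n) (u j i - u j' i) ^+ 2 <= 2 * \sum_(i < n) `|u j i - u j' i|.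
    by rewrite /delta; lra.
  rewrite mulr_sumr; apply: ler_sum => i _; rewrite -real_normK ?num_real //.
  rewrite expr2 ler_wpM2r // ler_norml.
  by have := u1 j i; have := u1 j' i; lra.
set N : R := #|B|%:R in ss *.
have /andP[dV Vd] := truncn_itv (le_trans ler01 V1).
have d1 : 1 <= (Num.truncn V)%:R :> R by rewrite ler1n truncn_gt0.
set d : R := (Num.truncn V)%:R in d1 dV.
have := card_trace_injective_le B s (Num.max d (3 * ln N / delta)) B0 Bs.
rewrite !le_max lexx ss orbT -/d => /(_ isT isT).
(* With few separating points the logarithm in the growth bound vanishes, so [ln N <= d <= V], and
   the lower bound 2 / 3 in [lnE] suffices. *)
have [_|dN] := leP (3 * ln N / delta) d.
  rewrite divff ?ln1 ?addr0 ?mulr1 => [lnNd|]; last by rewrite gt_eqF //; lra.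
  have : V * (2 / 3) <= V * ln (36 / eps ^+ 2) by rewrite ler_wpM2l //; lra.
  by rewrite -/N in lnNd *; lra.
have delta0 : 0 < delta by rewrite /delta; lra.
have lnN0 : 0 < ln N.
  have : 0 < 3 * ln N / delta by lra.
  by rewrite pmulr_lgt0 ?invr_gt0 //; lra.
pose x := ln N / d; have x0 : 0 < x by rewrite divr_gt0 //; lra.
(* A factor 12 comes from 3 and [delta]; the extra 3 leaves [x / 3], whose tangent bound [x / 3 - 1]
   cancels the 1 of the growth bound. *)
have -> : 3 * ln N / delta / d = 36 / eps ^+ 2 * (x / 3).
  by rewrite /x /delta; field; rewrite !gt_eqF //; lra.
rewrite lnM ?posrE ?divr_gt0 //; [|lra|lra].
(* This absorbs the double logarithm: [x <= 1 + l + ln (x / 3)]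
   then gives [x <= 3 / 2 * l]. *)
have : ln (x / 3) <= x / 3 - 1 by apply: ln_le_subr1; lra.
have -> : ln N = x * d by rewrite /x divfK // gt_eqF //; lra.
set l := ln (36 / _) in lnE *; move=> H1.
rewrite mulrC ler_pM2l; last by lra.
move=> H2; have xl : x <= 3 / 2 * l by lra.
have : d * (3 / 2 * l) <= V * (3 / 2 * l) by rewrite ler_wpM2r; lra.
have : d * x <= d * (3 / 2 * l) by rewrite ler_wpM2l; lra.
by lra.
Qed.

End MetricEntropy.

(** * Finite maxima and Rademacher averages *)

Section SupAbs.
Variables (R : realType) (I : finType).
Implicit Types (B : {set I}) (h : I -> R).

Definition supabs B h : R := \big[Num.max/0]_(j in B) `|h j|.

Lemma supabs_ge0 B h : 0 <= supabs B h.
Proof. exact: bigmax_ge_id. Qed.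

Lemma le_supabs B h j : j \in B -> `|h j| <= supabs B h.
Proof. by move=> jB; apply: (@le_bigmax_cond _ _ _ _ j). Qed.

Lemma supabs_le B h (c : R) : 0 <= c -> (forall j, j \in B -> `|h j| <= c) ->
  supabs B h <= c.
Proof. by move=> c0 hc; apply: bigmax_le. Qed.

Lemma supabsZ B h (c : R) : 0 <= c -> supabs B (fun j => c * h j) = c * supabs B h.
Proof.
by move=> c0; rewrite /supabs; elim/big_rec2: _ => [|j y1 y2 _ ->];
  rewrite ?mulr0 // normrM ger0_norm // maxr_pMr.
Qed.

End SupAbs.

(** Compares power series: odd terms cancel and [2 ^ k * k! <= (2 k)!] bounds the even ones, so that
    the first [2 n] terms on the left are matched with the first [n] on the right. *)
Lemma coshR_le (R : realType) (x : R) :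
  expR x + expR (- x) <= 2 * expR (x ^+ 2 / 2).
Proof.
have fact_le k : (2 ^ k * k`! <= (k.*2)`!)%N.
  elim: k => // k IH; rewrite doubleS 2!factS expnS factS mulnACA mul2n doubleS.
  by rewrite leq_mul // (leq_trans IH) // leq_pmull.
pose s y := series (exp_coeff y : R^nat).
have sE n : s x n.*2 + s (- x) n.*2 <= 2 * s (x ^+ 2 / 2) n.
  elim: n => [|n IH]; first by rewrite /s /series /= !big_geq //; lra.
  have oddE : exp_coeff (- x) n.*2.+1 = - exp_coeff x n.*2.+1.
    by rewrite /exp_coeff /= exprNn -signr_odd /= odd_double expr1 mulN1r mulNr.
  have evenE : exp_coeff (- x) n.*2 = exp_coeff x n.*2.
    by rewrite /exp_coeff /= exprNn -signr_odd odd_double expr0 mul1r.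
  have even_le : exp_coeff x n.*2 <= exp_coeff (x ^+ 2 / 2) n.
    rewrite /exp_coeff /= expr_div_n -exprM mul2n -mulrA -invfM.
    rewrite ler_wpM2l ?exprn_even_ge0 ?odd_double //.
    rewrite lef_pV2 ?posrE ?mulr_gt0 ?exprn_gt0 ?ltr0n ?fact_gt0 //.
    by rewrite -natrX -natrM ler_nat fact_le.
  by rewrite doubleS /s 5!seriesSr -!/(s _ _) oddE evenE; lra.
have dbl : (double @ \oo --> \oo)%classic.
  by under [double]funext => n do rewrite -mul2n; exact: cvg_mulnl.
have cvgs y : s y n @[n --> \oo] --> expR y by exact: is_cvg_series_exp_coeff.
have cvgs2 y : s y n.*2 @[n --> \oo] --> expR y.
  exact: (@cvg_comp _ _ _ double (s y) _ _ _ dbl (cvgs y)).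
have cvg2s : 2 * s (x ^+ 2 / 2) n @[n --> \oo] --> 2 * expR (x ^+ 2 / 2).
  by apply: cvgM; [exact: cvg_cst | exact: cvgs].
by apply: (ler_cvg_to (cvgD (cvgs2 x) (cvgs2 (- x))) cvg2s); exact: nearW.
Qed.

Section Rademacher.
Variables (R : realType) (n : nat).
Local Notation signs := {ffun 'I_n -> bool}.

Definition signed_sum (e : signs) (a : 'I_n -> R) : R :=
  \sum_(i < n) (-1) ^+ e i * a i.

Definition avg (g : signs -> R) : R := (\sum_(e : signs) g e) / (2 ^ n)%:R.

Lemma avg_le g g' : (forall e, g e <= g' e) -> avg g <= avg g'.
Proof.
by move=> gg'; rewrite ler_wpM2r ?invr_ge0 ?ler0n //; exact: ler_sum.
Qed.

Lemma avgD g g' : avg (fun e => g e + g' e) = avg g + avg g'.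
Proof. by rewrite /avg big_split mulrDl. Qed.

Lemma avgZ c g : avg (fun e => c * g e) = c * avg g.
Proof. by rewrite /avg -mulr_sumr mulrA. Qed.

Lemma avg_cst c : avg (fun=> c) = c.
Proof.
rewrite /avg sumr_const card_ffun card_bool card_ord -[c *+ _]mulr_natr mulfK //.
Qed.

Lemma avg_sum (I : finType) (B : {set I}) (g : I -> signs -> R) :
  avg (fun e => \sum_(j in B) g j e) = \sum_(j in B) avg (g j).
Proof. by rewrite /avg exchange_big mulr_suml. Qed.

Lemma expR_avg_le g : expR (avg g) <= avg (fun e => expR (g e)).
Proof.
set m := avg g; rewrite -[leLHS]mulr1.
have -> : 1 = avg (fun e => (1 - m) + g e) by rewrite avgD avg_cst -/m subrK.
rewrite -avgZ; apply: avg_le => e.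
by rewrite -[g e in leRHS](subrKC m) expRD ler_pM2l ?expR_gt0 // addrAC -addrA
  expR_ge1Dx.
Qed.

(** Averaging over all sign vectors factorises the product of exponentials into one hyperbolic
    cosine per coordinate. *)
Lemma avg_expR_signed_sum_le (a : 'I_n -> R) :
  avg (fun e => expR (signed_sum e a)) <= expR ((\sum_(i < n) a i ^+ 2) / 2).
Proof.
rewrite /avg ler_pdivrMr ?ltr0n ?expn_gt0 //.
under eq_bigr do rewrite /signed_sum expR_sum.
rewrite -(bigA_distr_bigA (fun i (b : bool) => expR ((-1) ^+ b * a i))) /=.
rewrite natrX mulrC mulr_suml expR_sum.
have -> : 2 ^+ n = \prod_(i < n) 2 :> R by rewrite prodr_const card_ord.
rewrite -big_split /=; apply: ler_prod => i _.
rewrite big_bool /= expr1 expr0 mulN1r mul1r addrC coshR_le andbT.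
by rewrite addr_ge0 ?expR_ge0.
Qed.

Definition rademacher (I : finType) (B : {set I}) (a : I -> 'I_n -> R) : R :=
  avg (fun e => supabs R I B (fun j => signed_sum e (a j))).

Lemma signed_sumN e (a : 'I_n -> R) :
  signed_sum e (fun i => - a i) = - signed_sum e a.
Proof. by rewrite /signed_sum -sumrN; apply: eq_bigr => i _; rewrite mulrN. Qed.

Lemma signed_sumZ e (c : R) (a : 'I_n -> R) :
  signed_sum e (fun i => c * a i) = c * signed_sum e a.
Proof.
by rewrite /signed_sum mulr_sumr; apply: eq_bigr => i _; rewrite mulrCA.
Qed.

Lemma signed_sumB e (a b : 'I_n -> R) :
  signed_sum e (fun i => a i - b i) = signed_sum e a - signed_sum e b.
Proof.
by rewrite /signed_sum -sumrB; apply: eq_bigr => i _; rewrite mulrBr.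
Qed.

(** Massart's finite class lemma: by Jensen, the exponential of [la] times the average is at most
    the average of a sum over [B] and both signs, that is of [2 * #|B|] sub-Gaussian terms. *)
Lemma massart (I : finType) (B : {set I}) (a : I -> 'I_n -> R) (r L : R) :
  (0 < #|B|)%N -> 0 < r -> 0 < L -> ln (2 * #|B|%:R) <= L ->
  (forall j, j \in B -> \sum_(i < n) a j i ^+ 2 <= r ^+ 2) ->
  rademacher I B a <= r * Num.sqrt (2 * L).
Proof.
move=> B0 r0 L0 lnB ar; set q := Num.sqrt (2 * L).
have q0 : 0 < q by rewrite sqrtr_gt0; lra.
have q2 : q ^+ 2 = 2 * L by rewrite sqr_sqrtr; lra.
(* This value minimises [L / la + la * r ^ 2 / 2]. *)
pose la := q / r; have la0 : 0 < la by rewrite divr_gt0.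
suff : la * rademacher I B a <= L + la ^+ 2 * r ^+ 2 / 2.
  rewrite -ler_pdivlMl // => /le_trans; apply.
  rewrite /la expr_div_n divfK ?expf_neq0 ?gt_eqF // q2 invf_div.
  rewrite (_ : L + 2 * L / 2 = q ^+ 2) ?q2; last by field.
  by rewrite -q2 expr2 mulrA divfK ?gt_eqF.
rewrite -ler_expR /rademacher -avgZ; apply: le_trans (expR_avg_le _) _.
pose ch e j := expR (signed_sum e (fun i => la * a j i)) +
  expR (signed_sum e (fun i => - (la * a j i))).
apply: (@le_trans _ _ (avg (fun e => \sum_(j in B) ch e j))).
  apply: avg_le => e; rewrite -supabsZ ?(ltW la0) //=.
  have /card_gt0P[j0 j0B] := B0.
  have ch_ge0 j : 0 <= ch e j by rewrite addr_ge0 ?expR_ge0.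
  have chS j : j \in B -> expR `|la * signed_sum e (a j)| <= \sum_(j in B) ch e j.
    move=> jB; rewrite (bigD1 j) //= (@le_trans _ _ (ch e j)) //; last first.
      by rewrite lerDl sumr_ge0.
    rewrite /ch signed_sumN signed_sumZ; set y := _ * _.
    by case: (ler0P y) => _; rewrite ?lerDl ?lerDr expR_ge0.
  rewrite -[leRHS]lnK ?ler_expR; last first.
    by rewrite posrE (lt_le_trans _ (chS _ j0B)) ?expR_gt0.
  have S0 : 0 < \sum_(j in B) ch e j.
    by rewrite (lt_le_trans _ (chS _ j0B)) ?expR_gt0.
  apply: supabs_le => [|j jB]; last by rewrite -ler_expR lnK ?posrE ?chS.
  by rewrite ln_ge0 // (le_trans _ (chS _ j0B)) // -expR0 ler_expR.
rewrite avg_sum.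
apply: (@le_trans _ _ (\sum_(j in B) 2 * expR (la ^+ 2 * r ^+ 2 / 2))).
  apply: ler_sum => j jB; rewrite /ch avgD mulr_natl mulr2n.
  have H b : (forall i, b i ^+ 2 = (la * a j i) ^+ 2) ->
      avg (fun e => expR (signed_sum e b)) <= expR (la ^+ 2 * r ^+ 2 / 2).
    move=> bE; apply: le_trans (avg_expR_signed_sum_le _) _.
    rewrite ler_expR ler_pM2r // (eq_bigr _ (fun i _ => bE i)).
    by under eq_bigr do rewrite exprMn; rewrite -mulr_sumr ler_wpM2l ?sqr_ge0 ?ar.
  by rewrite lerD ?H // => i; rewrite sqrrN.
rewrite sumr_const -[_ *+ _]mulr_natr mulrAC expRD ler_wpM2r ?expR_ge0 //.
by rewrite -[leLHS]lnK ?ler_expR // posrE mulr_gt0 ?ltr0n.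
Qed.

Lemma rademacher_link (I : finType) (B C : {set I}) (pi : I -> I)
    (a : I -> 'I_n -> R) : (forall j, j \in B -> pi j \in C) ->
  rademacher I B a <=
    rademacher I C a + rademacher I B (fun j i => a j i - a (pi j) i).
Proof.
move=> piC; rewrite /rademacher -avgD; apply: avg_le => e.
apply: supabs_le => [|j jB]; first by rewrite addr_ge0 ?supabs_ge0.
rewrite -[signed_sum e (a j)](subrKC (signed_sum e (a (pi j)))).
rewrite -signed_sumB (le_trans (ler_normD _ _)) // lerD //.
  exact: (le_supabs _ _ C (fun j => signed_sum e (a j)) _ (piC _ jB)).
exact: (le_supabs _ _ B (fun j => signed_sum e (fun i => a j i - a (pi j) i)) j jB).
Qed.

End Rademacher.

(** * Numerical estimates of logarithms and a limiting argument *)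

Section NumericBounds.
Variable R : realType.

Lemma ln_le_expn (x y : R) (k : nat) : 0 < x -> x <= (1 + y) ^+ k ->
  0 <= y -> ln x <= y * k%:R.
Proof.
move=> x0 xy y0; rewrite -ler_expR lnK // (le_trans xy) // expRM_natr.
by rewrite lerXn2r ?nnegrE ?expR_ge0 ?expR_ge1Dx ?addr_ge0.
Qed.

Lemma ln16_le : ln 16 <= 3 :> R.
Proof.
have -> : 3 = 1 / 16 * 48%:R :> R by lra.
apply: ln_le_expn => //; rewrite -[48%N]/(6 * 8)%N exprM.
have -> : (1 + 1 / 16 : R) = 17 / 16 by lra.
apply: (@le_trans _ _ ((143 / 100) ^+ 8)); first by rewrite !exprS expr0; lra.
by rewrite lerXn2r ?nnegrE ?exprn_ge0 //; rewrite ?exprS ?expr0; lra.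
Qed.

Lemma ln36_le : ln 36 <= 4 :> R.
Proof.
have -> : 4 = 1 / 8 * 32%:R :> R by lra.
apply: ln_le_expn => //; rewrite -[32%N]/(8 * 4)%N exprM.
have -> : (1 + 1 / 8 : R) = 9 / 8 by lra.
apply: (@le_trans _ _ ((256 / 100) ^+ 4)); first by rewrite !exprS expr0; lra.
by rewrite lerXn2r ?nnegrE ?exprn_ge0 //; rewrite ?exprS ?expr0; lra.
Qed.

Lemma ln2_le : ln 2 <= 3 / 4 :> R.
Proof.
have := ln16_le; have -> : 16 = 2 ^+ 4 :> R by rewrite -natrX.
by rewrite lnXn // -mulr_natr; lra.
Qed.

(** Lets the number of chaining levels tend to infinity, as the error of stopping at level [k]
    decays like [4 ^ (- k)]. *)
Lemma le_of_geometric_error (x y c : R) :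
  (forall k, x <= y + (4 ^+ k)^-1 * c) -> x <= y.
Proof.
move=> xy; apply/ler_addgt0Pr => e e0.
have [c0|c0] := leP c 0.
  by have := xy 0%N; rewrite expr0 invr1 mul1r; lra.
have ce0 : 0 <= c / e by rewrite divr_ge0 // ltW.
have /andP[_] := truncn_itv ce0; set k := (Num.truncn _).+1 => ck.
apply: (le_trans (xy k)); rewrite lerD2l mulrC ler_pdivrMr ?exprn_gt0 //.
rewrite -ler_pdivrMl // mulrC (le_trans (ltW ck)) // -natrX ler_nat ltnW //.
exact: ltn_expl.
Qed.

End NumericBounds.

(** * Chaining for a 1-Lipschitz image [v] of the class [u] *)

Section Chaining.
Variables (R : realType) (J : finType) (n : nat) (u v : J -> 'I_n -> R).
Variables (V s : R) (j0 : J).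
Hypothesis n0 : (0 < n)%N.
Hypothesis u1 : forall j i, -1 <= u j i <= 1.
Hypothesis V1 : 1 <= V.
Hypothesis uV : forall S : seq ('I_n * R), uniq S -> V < (size S)%:R ->
  ~ trace_full J _ (above R J n u) [set: J] S.
Hypothesis s01 : 0 < s <= 1.
Hypothesis us : forall j, \sum_(i < n) u j i ^+ 2 <= n%:R * s ^+ 2.
Hypothesis vu : forall j i, `|v j i| <= `|u j i|.
Hypothesis vuB : forall j j' i, `|v j i - v j' i| <= `|u j i - u j' i|.

Definition sqdist (j j' : J) : R := \sum_(i < n) (u j i - u j' i) ^+ 2.

(** A separated set that is maximal for inclusion is a net, since a point farther than [t] from it
    could be added. *)
Lemma exists_net (t : R) : 0 <= t -> exists2 B : {set J},
    (0 < #|B|)%N /\ {in B &, forall j j', j != j' -> t < sqdist j j'} &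
    exists pi : J -> J, forall j, pi j \in B /\ sqdist j (pi j) <= t.
Proof.
move=> t0.
pose sep (B : {set J}) :=
  [forall j in B, forall j' in B, (j != j') ==> (t < sqdist j j')].
have sepP B : sep B -> {in B &, forall j j', j != j' -> t < sqdist j j'}.
  by move=> /forall_inP H j j' /H /forall_inP H' /H' /implyP.
have sqdistC j j' : sqdist j j' = sqdist j' j.
  by apply: eq_bigr => i _; rewrite -sqrrN opprB.
have sqdistxx j : sqdist j j = 0.
  by apply: big1 => i _; rewrite subrr expr0n.
have sep0 : sep (finset.set1 j0).
  apply/forall_inP => j /finset.set1P ->; apply/forall_inP => j' /finset.set1P ->.
  by rewrite eqxx.
have [B /maxsetP[sepB maxB] j0B] := maxset_exists sep0.
have net j : exists j', (j' \in B) && (sqdist j j' <= t).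
  apply: contrapT => /forallNP far.
  have {}far j' : j' \in B -> t < sqdist j j'.
    by move=> j'B; have /negP := far j'; rewrite j'B /= -ltNge.
  have jB : j \in B.
    rewrite -(maxB (j |: B)) ?finset.setU11 //; last exact: finset.subsetU1.
    apply/forall_inP => k /finset.setU1P[->|kB];
      apply/forall_inP => l /finset.setU1P[->|lB].
    - by rewrite eqxx.
    - by apply/implyP => _; exact: far.
    - by apply/implyP => _; rewrite sqdistC; exact: far.
    - by apply/implyP; exact: (sepP _ sepB).
  by have := far j jB; rewrite sqdistxx ltNge t0.
exists B; first split; [|exact: (sepP _ sepB)|].
  by apply/card_gt0P; exists j0; apply: (fintype.subsetP j0B); rewrite inE.
by have [pi Hpi] := choice net; exists pi => j; apply/andP.
Qed.

Let L := ln (1 / s ^+ 2).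

(** The logarithm in [entropy_bound] is [ln 36 + L + (k + 1) * ln 16 <= 7 + L + 3 * k]. Doubling the
    cardinality, for both signs, costs [ln 2 <= 3 / 4]; raising 7 to 15 / 2 absorbs it as
    [V >= 1]. *)
Lemma net_entropy (B : {set J}) (k : nat) : (0 < #|B|)%N ->
  {in B &, forall j j', j != j' -> n%:R * (s / 4 ^+ k.+1) ^+ 2 < sqdist j j'} ->
  ln (2 * #|B|%:R) <= 3 / 2 * V * (15 / 2 + L + 3 * k%:R).
Proof.
move=> B0 sepB; have /andP[s0 s1] := s01.
have p4 : 0 < 4 ^+ k.+1 :> R by rewrite exprn_gt0.
have H : ln #|B|%:R <= 3 / 2 * (V * ln (36 / (s / 4 ^+ k.+1) ^+ 2)).
  apply: (entropy_bound R J n u V n0 u1 V1 uV) => //.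
  rewrite divr_gt0 //= ler_pdivrMr // mul1r (le_trans s1) // exprn_ege1 //.
  by rewrite ler1n.
rewrite lnM ?posrE ?ltr0n //.
have E : ln (36 / (s / 4 ^+ k.+1) ^+ 2) = ln 36 + L + ln 16 * k.+1%:R.
  have -> : 36 / (s / 4 ^+ k.+1) ^+ 2 = 36 * (1 / s ^+ 2) * 16 ^+ k.+1.
    have -> : 16 = 4 ^+ 2 :> R by rewrite -natrX.
    by rewrite -exprM mulnC exprM; field; rewrite !gt_eqF.
  have x0 : 0 < 1 / s ^+ 2 by rewrite divr_gt0 ?exprn_gt0.
  rewrite lnM ?posrE ?mulr_gt0 ?invr_gt0 ?exprn_gt0 //.
  rewrite [ln (36 * _)]lnM ?posrE //.
  by rewrite lnXn // mulr_natr.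
rewrite E -natr1 in H; have V0 := V1; have := ln2_le R.
have : ln 36 + L + ln 16 * (k%:R + 1) <= 7 + L + 3 * k%:R.
  have := ln36_le R; have := ln16_le R; have : 0 <= k%:R :> R by [].
  by move=> k0 l16 l36; have := ler_wpM2r k0 l16; lra.
move=> /(ler_wpM2l (le_trans ler01 V1)); lra.
Qed.

Lemma L_ge0 : 0 <= L.
Proof.
have /andP[s0 s1] := s01.
by rewrite ln_ge0 // ler_pdivlMr ?exprn_gt0 // mul1r expr_le1 // ltW.
Qed.

(** The mean of the entropy terms [15 / 2 + L + 3 * k] under weights proportional to [4 ^ (- k)],
    for which [k] has mean 1 / 3. *)
Let M := 17 / 2 + L.
Let c := s * Num.sqrt (3 * n%:R * V).

Lemma sqrt_tangent (A : R) : 0 <= A -> Num.sqrt A <= (A + M) / (2 * Num.sqrt M).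
Proof.
move=> A0; have M0 : 0 < M by have := L_ge0; rewrite /M; lra.
have q0 : 0 < Num.sqrt M by rewrite sqrtr_gt0.
rewrite ler_pdivlMr ?mulr_gt0 //.
have := sqr_ge0 (Num.sqrt A - Num.sqrt M).
by rewrite sqrrB !sqr_sqrtr ?(ltW M0) //; lra.
Qed.

(** The increments have radius [s / 4 ^ k], while the net indexing them is separated at the finer
    radius [s / 4 ^ (k + 1)]. The square root from Massart's lemma is linearised at the fixed [M],
    so that the levels can be summed explicitly. *)
Lemma massart_link (B : {set J}) (a : J -> 'I_n -> R) (k : nat) :
  (0 < #|B|)%N ->
  {in B &, forall j j', j != j' -> n%:R * (s / 4 ^+ k.+1) ^+ 2 < sqdist j j'} ->
  (forall j, j \in B -> \sum_(i < n) a j i ^+ 2 <= n%:R * (s / 4 ^+ k) ^+ 2) ->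
  rademacher R n J B a <= c / (2 * Num.sqrt M) *
    ((4 ^+ k)^-1 * (2 * M - 1 + 3 * k%:R)).
Proof.
move=> B0 sepB ak; have /andP[s0 _] := s01; have V0 := V1; have L0 := L_ge0.
have k0 : 0 <= k%:R :> R by [].
have p4 : 0 < 4 ^+ k :> R by rewrite exprn_gt0.
pose A := 15 / 2 + L + 3 * k%:R; have A0 : 0 < A by rewrite /A; lra.
have nR : 0 < n%:R :> R by rewrite ltr0n.
have := massart R n J B a (Num.sqrt n%:R * (s / 4 ^+ k)) (3 / 2 * V * A) B0.
rewrite mulr_gt0 ?sqrtr_gt0 ?divr_gt0 // => /(_ isT).
have -> : 0 < 3 / 2 * V * A by apply: mulr_gt0 => //; lra.
move=> /(_ isT (net_entropy B k B0 sepB)) H; apply: le_trans (H _) _.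
  by move=> j jB; rewrite exprMn sqr_sqrtr ?ler0n // ak.
have -> : 2 * (3 / 2 * V * A) = 3 * V * A by field.
have -> : Num.sqrt n%:R * (s / 4 ^+ k) * Num.sqrt (3 * V * A) =
    c * ((4 ^+ k)^-1 * Num.sqrt A).
  have -> : Num.sqrt (3 * V * A) = Num.sqrt (3 * V) * Num.sqrt A.
    by rewrite sqrtrM //; lra.
  rewrite /c (_ : 3 * n%:R * V = n%:R * (3 * V)); last by ring.
  by rewrite [in RHS]sqrtrM ?ler0n //; ring.
have -> : c / (2 * Num.sqrt M) * ((4 ^+ k)^-1 * (2 * M - 1 + 3 * k%:R)) =
    c * ((4 ^+ k)^-1 * ((A + M) / (2 * Num.sqrt M))).
  have -> : A + M = 2 * M - 1 + 3 * k%:R by rewrite /A /M; lra.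
  by set e := (4 ^+ k)^-1; set w := (2 * Num.sqrt M)^-1; ring.
have c0 : 0 <= c by rewrite mulr_ge0 ?sqrtr_ge0 ?ltW.
by rewrite ler_wpM2l // ler_wpM2l ?sqrt_tangent ?invr_ge0 ?ltW.
Qed.

Lemma sqdist_sub (j j' : J) : \sum_(i < n) (v j i - v j' i) ^+ 2 <= sqdist j j'.
Proof.
apply: ler_sum => i _.
by rewrite -[leLHS]real_normK ?num_real // -[leRHS]real_normK ?num_real //
  lerXn2r ?nnegrE ?vuB.
Qed.

(** By the choice of [M] the constants cancel, and the links [4 ^ (- k) * (2 * M - 1 + 3 * k)] sum
    to exactly [8 / 3 * M]. *)
Lemma rademacher_le : rademacher R n J [set: J] v <= 4 / 3 * c * Num.sqrt M.
Proof.
have /andP[s0 s1] := s01; have L0 := L_ge0.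
have M0 : 0 < M by rewrite /M; lra.
have q0 : 0 < Num.sqrt M by rewrite sqrtr_gt0.
pose b := c / (2 * Num.sqrt M).
have b0 : 0 <= b by rewrite divr_ge0 ?mulr_ge0 ?sqrtr_ge0 1?ltW.
have t0 k : 0 <= n%:R * (s / 4 ^+ k.+1) ^+ 2 by rewrite mulr_ge0 ?sqr_ge0.
have /choice[B HB] k : exists B : {set J}, [/\ (0 < #|B|)%N,
    {in B &, forall j j', j != j' -> n%:R * (s / 4 ^+ k.+1) ^+ 2 < sqdist j j'} &
    exists pi : J -> J, forall j, pi j \in B /\
      sqdist j (pi j) <= n%:R * (s / 4 ^+ k.+1) ^+ 2].
  by have [B [B0 sepB] piB] := exists_net _ (t0 k); exists B.
(* Closed form of the partial sums: the whole series minus its tail from [k + 1]. *)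
have chain k : rademacher R n J (B k) v <=
    b * (8 / 3 * M - (4 ^+ k.+1)^-1 * (8 / 3 * M + 4 * k.+1%:R)).
  elim: k => [|k IH].
    have [B0 sepB _] := HB 0%N.
    (* The first link is [v] itself, of radius [s] by [vu] and [us]. *)
    apply: le_trans (massart_link (B 0%N) v 0 B0 sepB _) _.
      move=> j _; rewrite expr0 divr1 (le_trans _ (us j)) // ler_sum // => i _.
      by rewrite -[leLHS]real_normK ?num_real // -[leRHS]real_normK ?num_real //
        lerXn2r ?nnegrE ?vu.
    by rewrite -/b ler_wpM2l // expr0 expr1; lra.
  have [B0 sepB _] := HB k.+1; have [_ _ [pi piB]] := HB k.
  apply: le_trans (rademacher_link R n J (B k.+1) (B k) pi v _) _.
    by move=> j _; have [] := piB j.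
  apply: le_trans (lerD IH (massart_link (B k.+1) _ k.+1 B0 sepB _)) _.
    by move=> j _; have [_] := piB j; exact: le_trans (sqdist_sub _ _).
  rewrite -/b -mulrDr ler_wpM2l // [4 ^+ k.+2]exprS invfM.
  rewrite (_ : k.+2%:R = k.+1%:R + 1 :> R) ?natr1 //.
  by set e := (4 ^+ k.+1)^-1; lra.
set T := (X in rademacher R n J X v).
(* The remainder from the last net to all of [J] is bounded crudely by the finite cardinality; [D]
   may be large because it comes with a factor [4 ^ (- k - 1)]. *)
pose D := Num.sqrt n%:R * s * Num.sqrt (2 * (1 + `|ln (2 * #|T|%:R)|)).
have J0 : (0 < #|T|)%N by apply/card_gt0P; exists j0; rewrite inE.
apply: (@le_of_geometric_error _ _ _ (D / 4)) => k.
have [_ _ [pi piB]] := HB k.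
apply: le_trans (rademacher_link R n J T (B k) pi v _) _.
  by move=> j _; have [] := piB j.
apply: lerD.
  apply: le_trans (chain k) _.
  have -> : 4 / 3 * c * Num.sqrt M = b * (8 / 3 * M).
    have := sqr_sqrtr (ltW M0); move: q0; rewrite /b.
    by move: (Num.sqrt M) => q q0 <-; field; exact: lt0r_neq0.
  rewrite ler_wpM2l // gerBl mulr_ge0 ?invr_ge0 ?exprn_ge0 //.
  by rewrite addr_ge0 // mulr_ge0 // ltW.
apply: le_trans (massart R n J T _ (Num.sqrt n%:R * (s / 4 ^+ k.+1))
  (1 + `|ln (2 * #|T|%:R)|) J0 _ _ _ _) _.
- by rewrite mulr_gt0 ?sqrtr_gt0 ?ltr0n // divr_gt0 ?exprn_gt0.
- exact: ltr_pwDl.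
- by rewrite (le_trans (ler_norm _)) // lerDr.
- move=> j _; rewrite exprMn sqr_sqrtr ?ler0n //.
  by have [_] := piB j; exact: le_trans (sqdist_sub _ _).
rewrite /D exprS invfM le_eqVlt; apply/orP; left; apply/eqP; field.
by rewrite lt0r_neq0 ?exprn_gt0.
Qed.

End Chaining.

(** * Rademacher averages in terms of the empirical second moment *)

Section RademacherVariance.
Variables (R : realType) (J : finType) (n : nat) (u v : J -> 'I_n -> R).
Variables (V sigma : R).
Hypothesis n0 : (0 < n)%N.
Hypothesis u1 : forall j i, -1 <= u j i <= 1.
Hypothesis V1 : 1 <= V.
Hypothesis uV : forall S : seq ('I_n * R), uniq S -> V < (size S)%:R ->
  ~ trace_full J _ (above R J n u) [set: J] S.
Hypothesis sigma0 : 0 < sigma.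
Hypothesis vu : forall j i, `|v j i| <= `|u j i|.
Hypothesis vuB : forall j j' i, `|v j i - v j' i| <= `|u j i - u j' i|.

Let m := supabs R J [set: J] (fun j => \sum_(i < n) u j i ^+ 2).

(* The logarithm is linearised at [sigma ^+ 2], so that the right-hand side is
   the square root of an affine function of the empirical variance. *)
Lemma rademacher_le_variance :
  rademacher R n J [set: J] v <= 237 / 100 *
    Num.sqrt (V * (m * (Lsig sigma - 1) + n%:R * sigma ^+ 2)).
Proof.
have nR : 0 < n%:R :> R by rewrite ltr0n.
have V0 : 0 < V := lt_le_trans ltr01 V1.
have sig2 : 0 < sigma ^+ 2 by rewrite exprn_gt0.
have um j : \sum_(i < n) u j i ^+ 2 <= m.
  rewrite (le_trans (ler_norm _)) //.
  by apply: (le_supabs R J [set: J] (fun j => \sum_(i < n) u j i ^+ 2)); rewrite inE.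
have m0 : 0 <= m by exact: supabs_ge0.
have mn : m <= n%:R.
  apply: supabs_le => // j _; rewrite ger0_norm; last first.
    by rewrite sumr_ge0 // => i _; exact: sqr_ge0.
  rewrite -[n in n%:R]card_ord -sum1_card natr_sum ler_sum // => i _.
  by rewrite -real_normK ?num_real // expr_le1 // ler_norml.
(* Chaining starts from a positive radius; if [m = 0] every [v j i] vanishes. *)
have [mE|mN0] := eqVneq m 0.
  suff -> : rademacher R n J [set: J] v = 0 by rewrite mulr_ge0 ?sqrtr_ge0.
  rewrite /rademacher -[RHS](avg_cst R n 0); congr avg; apply/funext => e.
  apply/eqP; rewrite eq_le supabs_ge0 andbT supabs_le // => j _.
  rewrite /signed_sum big1 ?normr0 // => i _.
  suff -> : v j i = 0 by rewrite mulr0.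
  apply/eqP; rewrite -normr_le0 (le_trans (vu j i)) //.
  have : \sum_(i < n) u j i ^+ 2 == 0.
    have := um j; rewrite mE eq_le => -> /=.
    by rewrite sumr_ge0 // => k _; exact: sqr_ge0.
  rewrite psumr_eq0 => [/allP /(_ i)|k _]; last exact: sqr_ge0.
  by rewrite mem_index_enum sqrf_eq0 => /(_ isT)/eqP ->; rewrite normr0.
have {}m0 : 0 < m by rewrite lt_neqAle eq_sym mN0.
have [j0 _] : exists j : J, true.
  apply: contrapT => /forallNP J0; have : m <= 0.
    by apply: supabs_le => // j _; have := J0 j.
  by rewrite leNgt m0.
pose s := Num.sqrt (m / n%:R).
have mn0 : 0 < m / n%:R by rewrite divr_gt0.
have s2 : s ^+ 2 = m / n%:R by rewrite sqr_sqrtr // ltW.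
have s0 : 0 < s by rewrite sqrtr_gt0.
have s01 : 0 < s <= 1.
  by rewrite s0 /= -(@expr_le1 _ 2) ?(ltW s0) // s2 ler_pdivrMr // mul1r.
have us j : \sum_(i < n) u j i ^+ 2 <= n%:R * s ^+ 2.
  by rewrite s2 mulrC divfK ?gt_eqF.
have := rademacher_le R J n u v V s j0 n0 u1 V1 uV s01 us vu vuB.
move/le_trans; apply; set L := ln _.
have L0 : 0 <= L.
  by rewrite ln_ge0 // ler_pdivlMr ?exprn_gt0 // s2 mul1r ler_pdivrMr // mul1r.
(* From [ln x <= x - 1] at [x = sigma ^ 2 / s ^ 2]; the constant [911 / 100] in [Lsig] exceeds the
   17 / 2 required. *)
have LL : s ^+ 2 * (17 / 2 + L) <= s ^+ 2 * (Lsig sigma - 1) + sigma ^+ 2.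
  have -> : L = ln (1 / sigma ^+ 2) + ln (sigma ^+ 2 / s ^+ 2).
    rewrite -lnM ?posrE ?divr_gt0 ?exprn_gt0 //; congr ln.
    by field; rewrite !gt_eqF.
  have := ln_le_subr1 R (sigma ^+ 2 / s ^+ 2); rewrite divr_gt0 ?exprn_gt0 //.
  move=> /(_ isT) H; rewrite /Lsig; set l := ln (1 / _).
  have {H} : s ^+ 2 * ln (sigma ^+ 2 / s ^+ 2) <= sigma ^+ 2 - s ^+ 2.
    have := ler_wpM2l (sqr_ge0 s) H.
    by rewrite mulrBr mulr1 mulrCA mulfV ?mulr1 // gt_eqF // exprn_gt0.
  have s20 : 0 < s ^+ 2 by rewrite exprn_gt0.
  lra.
have nLL : m * (17 / 2 + L) <= m * (Lsig sigma - 1) + n%:R * sigma ^+ 2.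
  have -> : m = n%:R * s ^+ 2 by rewrite s2 mulrC divfK ?gt_eqF.
  by have := ler_wpM2l (ltW nR) LL; lra.
have M0 : 0 <= 17 / 2 + L by lra.
have nV0 : 0 <= 3 * n%:R * V by rewrite !mulr_ge0 // ltW.
have X0 : 0 <= V * (m * (17 / 2 + L)) by rewrite !mulr_ge0 // ltW.
have XY : V * (m * (17 / 2 + L)) <= V * (m * (Lsig sigma - 1) + n%:R * sigma ^+ 2).
  by rewrite ler_pM2l.
rewrite -(@ler_pXn2r _ 2) ?nnegrE ?mulr_ge0 ?sqrtr_ge0 ?(ltW s0) //.
rewrite [leRHS]exprMn [in leRHS]sqr_sqrtr ?(le_trans X0) //.
(* The constant 16 / 3 is below the square of [237 / 100]. *)
have -> : (4 / 3 * (s * Num.sqrt (3 * n%:R * V)) * Num.sqrt (17 / 2 + L)) ^+ 2 =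
    16 / 3 * (V * (m * (17 / 2 + L))).
  rewrite !exprMn !sqr_sqrtr ?(ltW mn0) //; field; exact: lt0r_neq0.
rewrite [(237 / 100) ^+ 2]expr2; lra.
Qed.

End RademacherVariance.

(** * Expectations of bounded measurable functions *)

Section BoundedMeasurable.
Context d (T : measurableType d) (R : realType).
Implicit Types f g : T -> R.

(** A class stable under the operations below and integrable for every probability, so that
    integrability reduces to closure lemmas. *)
Definition bounded_measurable f :=
  measurable_fun setT f /\ exists c, forall x, `|f x| <= c.

Lemma bounded_measurable_cst c : bounded_measurable (cst c).
Proof. by split; [exact: measurable_cst | exists `|c|]. Qed.

Lemma bounded_measurableD f g : bounded_measurable f -> bounded_measurable g ->
  bounded_measurable (fun x => f x + g x).
Proof.
move=> [mf [c fc]] [mg [c' gc]]; split; first exact: measurable_funD.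
by exists (c + c') => x; rewrite (le_trans (ler_normD _ _)) ?lerD.
Qed.

Lemma bounded_measurableM f g : bounded_measurable f -> bounded_measurable g ->
  bounded_measurable (fun x => f x * g x).
Proof.
move=> [mf [c fc]] [mg [c' gc]]; split; first exact: measurable_funM.
by exists (c * c') => x; rewrite normrM ler_pM.
Qed.

Lemma bounded_measurableZ (a : R) f : bounded_measurable f ->
  bounded_measurable (fun x => a * f x).
Proof. exact/bounded_measurableM/bounded_measurable_cst. Qed.

Lemma bounded_measurableB f g : bounded_measurable f -> bounded_measurable g ->
  bounded_measurable (fun x => f x - g x).
Proof.
move=> bf bg; under eq_fun do rewrite -mulN1r.
exact/(bounded_measurableD _ _ bf)/bounded_measurableZ.
Qed.

Lemma bounded_measurable_norm f : bounded_measurable f ->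
  bounded_measurable (fun x => `|f x|).
Proof.
move=> [mf [c fc]]; split; first exact: measurableT_comp.
by exists c => x; rewrite normr_id.
Qed.

Lemma bounded_measurable_max f g : bounded_measurable f -> bounded_measurable g ->
  bounded_measurable (fun x => Num.max (f x) (g x)).
Proof.
move=> [mf [c fc]] [mg [c' gc]]; split; first exact: measurable_maxr.
exists (Num.max c c') => x; rewrite /Num.max le_max.
by case: ifP => _; rewrite ?fc ?gc ?orbT.
Qed.

Lemma bounded_measurable_sum (I : Type) (r : seq I) (p : pred I) (F : I -> T -> R) :
  (forall i, bounded_measurable (F i)) ->
  bounded_measurable (fun x => \sum_(i <- r | p i) F i x).
Proof.
move=> bF; elim: r => [|i r IH].
  by under eq_fun do rewrite big_nil; exact: bounded_measurable_cst.
under eq_fun do rewrite big_cons.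
by case: (p i) => //; exact: bounded_measurableD.
Qed.

Lemma bounded_measurable_supabs (I : finType) (B : {set I}) (F : I -> T -> R) :
  (forall i, bounded_measurable (F i)) ->
  bounded_measurable (fun x => supabs R I B (fun i => F i x)).
Proof.
move=> bF; rewrite /supabs; elim: (index_enum I) => [|i r IH].
  by under eq_fun do rewrite big_nil; exact: bounded_measurable_cst.
under eq_fun do rewrite big_cons.
case: (i \in B) => //; apply: bounded_measurable_max => //.
exact: bounded_measurable_norm.
Qed.

Variable P : probability T R.

Lemma bounded_measurable_integrable f : bounded_measurable f ->
  P.-integrable setT (EFin \o f).
Proof.
move=> [mf [c fc]]; apply: measurable_bounded_integrable => //.
  by rewrite (le_lt_trans (probability_le1 P measurableT)) ?ltry.
by exists c; split; [exact: num_real | move=> M /ltW cM x _; exact: le_trans (fc x) cM].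
Qed.

Lemma EFin_Ereal f : bounded_measurable f ->
  (Ereal P f)%:E = (\int[P]_w (f w)%:E)%E.
Proof.
move=> bf; rewrite fineK // integrable_fin_num //.
exact: bounded_measurable_integrable.
Qed.

Lemma Ereal_le f g : bounded_measurable f -> bounded_measurable g ->
  (forall x, f x <= g x) -> Ereal P f <= Ereal P g.
Proof.
by move=> bf bg fg; apply: le_Rintegral => //; exact: bounded_measurable_integrable.
Qed.

Lemma Ereal_cst c : Ereal P (cst c) = c.
Proof.
rewrite -[RHS]/(fine c%:E); congr fine.
by rewrite [LHS](integral_cst P measurableT c%:E) /= probability_setT mule1.
Qed.

Lemma ErealD f g : bounded_measurable f -> bounded_measurable g ->
  Ereal P (fun x => f x + g x) = Ereal P f + Ereal P g.
Proof.
by move=> bf bg; apply: RintegralD => //; exact: bounded_measurable_integrable.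
Qed.

Lemma ErealZ c f : bounded_measurable f ->
  Ereal P (fun x => c * f x) = c * Ereal P f.
Proof.
by move=> bf; apply: RintegralZl => //; exact: bounded_measurable_integrable.
Qed.

Lemma ErealB f g : bounded_measurable f -> bounded_measurable g ->
  Ereal P (fun x => f x - g x) = Ereal P f - Ereal P g.
Proof.
by move=> bf bg; apply: RintegralB => //; exact: bounded_measurable_integrable.
Qed.

Lemma Ereal_sum (I : Type) (r : seq I) (F : I -> T -> R) :
  (forall i, bounded_measurable (F i)) ->
  Ereal P (fun x => \sum_(i <- r) F i x) = \sum_(i <- r) Ereal P (F i).
Proof.
move=> bF; elim: r => [|i r IH].
  by under eq_fun do rewrite big_nil; rewrite big_nil Ereal_cst.
under eq_fun do rewrite big_cons.
by rewrite ErealD ?IH ?big_cons //; exact: bounded_measurable_sum.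
Qed.

Lemma Ereal_norm_le f : bounded_measurable f ->
  `|Ereal P f| <= Ereal P (fun x => `|f x|).
Proof.
move=> bf; have bnf := bounded_measurable_norm _ bf.
rewrite ler_norml; apply/andP; split; last by apply: Ereal_le => // x; exact: ler_norm.
rewrite -mulN1r -ErealZ //; apply: Ereal_le => // [|x].
  exact: bounded_measurableZ.
by rewrite mulN1r lerNl -normrN ler_norm.
Qed.

End BoundedMeasurable.

Lemma bounded_measurable_comp d d' (T : measurableType d) (T' : measurableType d')
    (R : realType) (h : T' -> T) (f : T -> R) :
  measurable_fun setT h -> bounded_measurable d T R f ->
  bounded_measurable d' T' R (f \o h).
Proof.
move=> mh [mf [c fc]]; split; first exact: measurableT_comp.
by exists c => x; exact: fc.
Qed.

(** * Product space and measurable rectangles *)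

Section ProductSpace.
Context d (T : measurableType d) (R : realType) (P : probability T R).
Let PP : probability (T * T)%type R := (P \x P)%E.

Lemma bounded_measurable_fst (f : T -> R) : bounded_measurable d T R f ->
  bounded_measurable _ (T * T)%type R (fun p => f p.1).
Proof. exact: (bounded_measurable_comp _ _ _ _ _ fst f measurable_fst). Qed.

Lemma bounded_measurable_snd (f : T -> R) : bounded_measurable d T R f ->
  bounded_measurable _ (T * T)%type R (fun p => f p.2).
Proof. exact: (bounded_measurable_comp _ _ _ _ _ snd f measurable_snd). Qed.

Lemma Ereal_fst (f : T -> R) : bounded_measurable d T R f -> (forall x, 0 <= f x) ->
  Ereal PP (fun p => f p.1) = Ereal P f.
Proof.
move=> bf f0; congr fine.
rewrite fubini_tonelli1 /=.
- apply: eq_integral => x _.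
  by rewrite [LHS](integral_cst P measurableT (f x)%:E) /= probability_setT mule1.
- by apply/measurable_EFinP; exact: (bounded_measurable_fst _ bf).1.
- by move=> p; rewrite lee_fin.
Qed.

Lemma Ereal_snd (f : T -> R) : bounded_measurable d T R f -> (forall x, 0 <= f x) ->
  Ereal PP (fun p => f p.2) = Ereal P f.
Proof.
move=> bf f0; congr fine.
rewrite fubini_tonelli2 /=.
- apply: eq_integral => x _.
  by rewrite [LHS](integral_cst P measurableT (f x)%:E) /= probability_setT mule1.
- by apply/measurable_EFinP; exact: (bounded_measurable_snd _ bf).1.
- by move=> p; rewrite lee_fin.
Qed.

End ProductSpace.

Section TupleRectangles.
Context d (Xs : measurableType d) (n : nat).

Definition tuple_rectangles : set (set (n.-tuple (Xs * Xs))) :=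
  [set C | exists A B : 'I_n -> set Xs, [/\ forall i, measurable (A i),
    forall i, measurable (B i) &
    C = [set t | forall i, A i (tnth t i).1 /\ B i (tnth t i).2]]].

Lemma tuple_rectangles_setI : setI_closed tuple_rectangles.
Proof.
move=> _ _ [A [B [mA mB ->]]] [A' [B' [mA' mB' ->]]].
exists (fun i => A i `&` A' i), (fun i => B i `&` B' i); split.
- by move=> i; exact: measurableI.
- by move=> i; exact: measurableI.
rewrite eqEsubset; split=> t /=.
  by move=> [H H'] i; have [? ?] := H i; have [? ?] := H' i.
by move=> H; split=> i; have [[? ?] [? ?]] := H i.
Qed.

Lemma tuple_rectangles_setT : tuple_rectangles setT.
Proof.
by exists (fun=> setT), (fun=> setT); split => //; rewrite eqEsubset; split.
Qed.

(** In the harder inclusion, each component of each pair is measurable for the generated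
    sigma-algebra, its preimages being rectangles whose other sides are full. *)
Lemma measurable_tuple_rectangles : measurable = <<s tuple_rectangles >>.
Proof.
rewrite eqEsubset; split; last first.
  apply: smallest_sub; first exact: sigma_algebra_measurable.
  move=> _ [A [B [mA mB ->]]].
  rewrite (_ : [set t | _] =
    \bigcap_(i in [set: 'I_n]) ((fun t => tnth t i) @^-1` (A i `*` B i))).
    apply: fin_bigcap_measurable => // i _; rewrite -[X in measurable X]setTI.
    by apply: measurable_tnth => //; exact: measurableX.
  by rewrite eqEsubset; split=> t /= H i; [move=> _; exact: H | exact: H i I].
have mtnth : measurable_fun setT
    (id : g_sigma_algebraType tuple_rectangles -> n.-tuple (Xs * Xs)).
  apply/measurable_fun_tnthP => i; apply/measurable_fun_pairP.
  split=> _ D mD; rewrite setTI; apply: sub_sigma_algebra.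
    exists (fun k => if k == i then D else setT), (fun=> setT); split => //.
      by move=> k; case: ifP.
    rewrite eqEsubset; split=> t /=; last by move=> /(_ i); rewrite eqxx => -[].
    by move=> H k; case: eqP => // ->.
  exists (fun=> setT), (fun k => if k == i then D else setT); split => //.
    by move=> k; case: ifP.
  rewrite eqEsubset; split=> t /=; last by move=> /(_ i); rewrite eqxx => -[].
  by move=> H k; case: eqP => // ->.
by move=> A mA; have := mtnth measurableT A mA; rewrite setTI.
Qed.

End TupleRectangles.

(** * Symmetrization by an independent copy *)

Section Symmetrization.
Context d d' (T : measurableType d) (Xs : measurableType d') (R : realType).
Variables (P : probability T R) (n : nat) (X : 'I_n -> T -> Xs).
Hypothesis mX : forall i, measurable_fun setT (X i).
Hypothesis indepX : mutually_independent P X.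
Let PP : probability (T * T)%type R := (P \x P)%E.

(** Under the product measure, [p.2] yields an independent copy of the sample given by [p.1]. *)
Definition swapped_pairs (e : {ffun 'I_n -> bool}) (p : T * T) : n.-tuple (Xs * Xs) :=
  [tuple if e i then (X i p.2, X i p.1) else (X i p.1, X i p.2) | i < n].

Lemma measurable_swapped_pairs e : measurable_fun setT (swapped_pairs e).
Proof.
apply/measurable_fun_tnthP => i.
rewrite (_ : _ \o _ = fun p => if e i then (X i p.2, X i p.1)
  else (X i p.1, X i p.2)); last by apply/funext => p; rewrite /= tnth_mktuple.
have m1 : measurable_fun setT (fun p : T * T => X i p.1) by exact: measurableT_comp.
have m2 : measurable_fun setT (fun p : T * T => X i p.2) by exact: measurableT_comp.
by case: (e i); exact: measurable_fun_pair.
Qed.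

(** The preimage is a product of two intersections, so independence turns its measure into a product
    in which an exchange only permutes factors. *)
Lemma swapped_pairs_rectangle e (A B : 'I_n -> set Xs) :
  (forall i, measurable (A i)) -> (forall i, measurable (B i)) ->
  PP (swapped_pairs e @^-1` [set t | forall i, A i (tnth t i).1 /\ B i (tnth t i).2])
  = (\prod_(i < n) (P (X i @^-1` A i) * P (X i @^-1` B i)))%E.
Proof.
move=> mA mB.
pose U i := if e i then B i else A i; pose W i := if e i then A i else B i.
have mU i : measurable (U i) by rewrite /U; case: (e i).
have mW i : measurable (W i) by rewrite /W; case: (e i).
have mXI (C : 'I_n -> set Xs) : (forall i, measurable (C i)) ->
    measurable (\bigcap_(i in [set: 'I_n]) (X i @^-1` C i)).
  move=> mC; apply: fin_bigcap_measurable => // i _.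
  by rewrite -[X in measurable X]setTI; exact: mX.
rewrite (_ : _ @^-1` _ = (\bigcap_(i in [set: 'I_n]) (X i @^-1` U i)) `*`
    (\bigcap_(i in [set: 'I_n]) (X i @^-1` W i))); last first.
  rewrite eqEsubset; split=> -[w w'] /=.
    move=> H; split=> i _ /=; have := H i; rewrite tnth_mktuple /U /W /=;
    by case: (e i) => -[].
  move=> [HU HW] i; have := HU i I; have := HW i I.
  by rewrite tnth_mktuple /U /W /=; case: (e i).
rewrite [LHS](product_measure1E P P (mXI _ mU) (mXI _ mW)).
apply: (etrans (congr2 mule (indepX _ mU) (indepX _ mW))).
rewrite -big_split /=; apply: eq_bigr => i _.
by rewrite /U /W; case: (e i) => //; rewrite muleC.
Qed.

Lemma swapped_pairs_law e e' (D : set (n.-tuple (Xs * Xs))) : measurable D ->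
  PP (swapped_pairs e @^-1` D) = PP (swapped_pairs e' @^-1` D).
Proof.
move=> mD.
apply: (measure_unique (tuple_rectangles d' Xs n) (fun=> setT)
  (measurable_tuple_rectangles _ _ _) (tuple_rectangles_setI _ _ _) _ _
  (pushforward PP (swapped_pairs e)) (pushforward PP (swapped_pairs e'))) => //.
- by move=> _; exact: tuple_rectangles_setT.
- by rewrite bigcup_const.
- exact: measurable_swapped_pairs.
- exact: measurable_swapped_pairs.
- move=> ? ? _ [A [B [mA mB ->]]].
  exact: etrans (swapped_pairs_rectangle e _ _ mA mB)
    (esym (swapped_pairs_rectangle e' _ _ mA mB)).
- move=> ? _; apply: le_lt_trans (_ : PP setT < +oo)%E; first by [].
  by rewrite probability_setT ltry.
Qed.

Lemma Ereal_swapped_pairs e e' (phi : n.-tuple (Xs * Xs) -> R) :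
  measurable_fun setT phi -> (forall t, 0 <= phi t) ->
  Ereal PP (phi \o swapped_pairs e) = Ereal PP (phi \o swapped_pairs e').
Proof.
move=> mphi phi0; congr fine.
have pushE k : (\int[PP]_p (phi (swapped_pairs k p))%:E =
    \int[pushforward PP (swapped_pairs k)]_t (phi t)%:E)%E.
  rewrite (ge0_integral_pushforward (measurable_swapped_pairs k)) ?preimage_setT //.
    exact/measurable_EFinP.
  by move=> t _; rewrite lee_fin.
rewrite [LHS]pushE [RHS]pushE.
apply: eq_measure_integral; [exact: measurable_swapped_pairs..|].
by move=> ? ? D mD _; exact: (swapped_pairs_law e e' D mD).
Qed.

Section FiniteClass.
Variables (J : finType) (g : J -> Xs -> R).
Hypothesis bg : forall j, bounded_measurable d' Xs R (g j).

Let bgX j i : bounded_measurable d T R (fun w => g j (X i w)).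
Proof. exact: (bounded_measurable_comp _ _ _ _ _ _ _ (mX i) (bg j)). Qed.

Lemma bounded_measurable_rademacher :
  bounded_measurable d T R
    (fun w => rademacher R n J [set: J] (fun j i => g j (X i w))).
Proof.
rewrite /rademacher /avg; under eq_fun do rewrite mulrC.
apply/bounded_measurableZ/bounded_measurable_sum => e.
apply: bounded_measurable_supabs => j; apply: bounded_measurable_sum => i.
exact: bounded_measurableZ.
Qed.

Let diff (p : T * T) (j : J) (i : 'I_n) : R := g j (X i p.1) - g j (X i p.2).

Let bdiff j i : bounded_measurable _ (T * T)%type R (fun p => diff p j i).
Proof.
apply: bounded_measurableB.
  exact: (bounded_measurable_fst _ _ _ _ (bgX j i)).
exact: (bounded_measurable_snd _ _ _ _ (bgX j i)).
Qed.

(** The centring is an expectation over the copy; the absolute value moves inside it, and each term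
    is then at most the maximum. *)
Lemma Ereal_supabs_le_copy :
  Ereal P (fun w => supabs R J [set: J]
    (fun j => \sum_(i < n) (g j (X i w) - Ereal P (g j \o X i)))) <=
  Ereal PP (fun p => supabs R J [set: J] (fun j => \sum_(i < n) diff p j i)).
Proof.
set h := fun p : T * T => supabs _ _ _ _.
have bh : bounded_measurable _ (T * T)%type R h.
  by apply: bounded_measurable_supabs => j; exact: bounded_measurable_sum.
have bl : bounded_measurable d T R (fun w => supabs R J [set: J]
    (fun j => \sum_(i < n) (g j (X i w) - Ereal P (g j \o X i)))).
  apply: bounded_measurable_supabs => j; apply: bounded_measurable_sum => i.
  exact/bounded_measurableB/bounded_measurable_cst.
rewrite -lee_fin !EFin_Ereal //.
have mh : measurable_fun setT (EFin \o h) by apply/measurable_EFinP; have [] := bh.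
have h0 p : (0 <= (EFin \o h) p)%E by rewrite lee_fin supabs_ge0.
rewrite (_ : (\int[PP]_p (h p)%:E)%E = (\int[P]_w (\int[P]_w' (h (w, w'))%:E))%E);
  last exact: (@fubini_tonelli1 _ _ _ _ R P P _ mh h0).
apply: ge0_le_integral => //.
- by move=> w _; rewrite lee_fin supabs_ge0.
- by apply/measurable_EFinP; have [] := bl.
- exact: (@measurable_fun_fubini_tonelli_F _ _ _ _ R P _ mh h0).
move=> w _.
have bhw : bounded_measurable d T R (fun w' => h (w, w')).
  apply: bounded_measurable_supabs => j; apply: bounded_measurable_sum => i.
  apply: bounded_measurableB; last exact: bgX.
  exact: (bounded_measurable_cst d T R (g j (X i w))).
rewrite -EFin_Ereal // lee_fin; apply: supabs_le => [|j _].
  rewrite -(Ereal_cst d T R P 0); apply: Ereal_le => //.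
    exact: bounded_measurable_cst.
  by move=> w'; exact: supabs_ge0.
have bs : bounded_measurable d T R (fun w' => \sum_(i < n) diff (w, w') j i).
  apply: bounded_measurable_sum => i; apply: bounded_measurableB; last exact: bgX.
  exact: (bounded_measurable_cst d T R (g j (X i w))).
have -> : \sum_(i < n) (g j (X i w) - Ereal P (g j \o X i)) =
    Ereal P (fun w' => \sum_(i < n) diff (w, w') j i).
  rewrite Ereal_sum => [|i]; last first.
    apply: bounded_measurableB; last exact: bgX.
    exact: (bounded_measurable_cst d T R (g j (X i w))).
  apply: eq_bigr => i _; rewrite /diff /=.
  rewrite (ErealB d T R P (cst (g j (X i w)))); last exact: bgX;
    last exact: bounded_measurable_cst.
  by rewrite (Ereal_cst d T R P (g j (X i w))).
apply: (le_trans (Ereal_norm_le _ _ _ _ _ bs)).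
apply: Ereal_le => // [|w']; first exact: bounded_measurable_norm.
apply: (le_supabs R J [set: J] (fun j => \sum_(i < n) diff (w, w') j i)).
by rewrite inE.
Qed.

(** Exchanging pairs flips signs without changing the expectation, which may thus be averaged over
    all sign vectors; the triangle inequality then splits the differences into two Rademacher
    averages, one per copy. *)
Lemma Ereal_copy_le_rademacher :
  Ereal PP (fun p => supabs R J [set: J] (fun j => \sum_(i < n) diff p j i)) <=
  2 * Ereal P (fun w => rademacher R n J [set: J] (fun j i => g j (X i w))).
Proof.
pose phi (t : n.-tuple (Xs * Xs)) := supabs R J [set: J]
  (fun j => \sum_(i < n) (g j (tnth t i).1 - g j (tnth t i).2)).
have mphi : measurable_fun setT phi.
  apply: (proj1 (bounded_measurable_supabs _ _ R J [set: J] _ _)) => j.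
  apply: bounded_measurable_sum => i; apply: bounded_measurableB.
    apply: (bounded_measurable_comp _ _ _ _ R (fun t => (tnth t i).1) _ _ (bg j)).
    by apply: measurableT_comp => //; exact: measurable_tnth.
  apply: (bounded_measurable_comp _ _ _ _ R (fun t => (tnth t i).2) _ _ (bg j)).
  by apply: measurableT_comp => //; exact: measurable_tnth.
have phi0 t : 0 <= phi t by exact: supabs_ge0.
have phiE e p : phi (swapped_pairs e p) =
    supabs R J [set: J] (fun j => signed_sum R n e (diff p j)).
  congr supabs; apply/funext => j; apply: eq_bigr => i _.
  rewrite tnth_mktuple /diff; case: (e i) => /=; last by rewrite expr0 mul1r.
  by rewrite expr1 mulN1r opprB.
pose e0 : {ffun 'I_n -> bool} := [ffun=> false].
have bse e : bounded_measurable _ (T * T)%type R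
    (fun p => supabs R J [set: J] (fun j => signed_sum R n e (diff p j))).
  apply: bounded_measurable_supabs => j; apply: bounded_measurable_sum => i.
  exact: bounded_measurableZ.
have swapE e :
    Ereal PP (fun p => supabs R J [set: J] (fun j => \sum_(i < n) diff p j i)) =
    Ereal PP (fun p => supabs R J [set: J] (fun j => signed_sum R n e (diff p j))).
  transitivity (Ereal PP (phi \o swapped_pairs e0)).
    congr Ereal; apply/funext => p; rewrite /= phiE; congr supabs.
    apply/funext => j; apply: eq_bigr => i _.
    by rewrite ffunE expr0 mul1r.
  rewrite (Ereal_swapped_pairs e0 e) //.
  by congr Ereal; apply/funext => p; rewrite /= phiE.
rewrite -[leLHS](avg_cst R n) /avg (eq_bigr _ (fun e _ => swapE e)).
rewrite -Ereal_sum // mulrC -(ErealZ _ _ _ PP); last exact: bounded_measurable_sum.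
pose rad w := rademacher R n J [set: J] (fun j i => g j (X i w)).
have brad : bounded_measurable d T R rad by exact: bounded_measurable_rademacher.
have rad0 w : 0 <= rad w.
  by rewrite mulr_ge0 ?invr_ge0 // sumr_ge0 // => e _; exact: supabs_ge0.
have brad1 := bounded_measurable_fst _ _ _ _ brad.
have brad2 := bounded_measurable_snd _ _ _ _ brad.
have -> : 2 * Ereal P rad = Ereal PP (fun p => rad p.1 + rad p.2).
  by rewrite ErealD // (Ereal_fst _ _ _ P) // (Ereal_snd _ _ _ P) // mulr_natl mulr2n.
apply: Ereal_le.
- by apply: bounded_measurableZ; exact: bounded_measurable_sum.
- exact: bounded_measurableD.
move=> p; rewrite mulrC -/(avg R n _) -avgD; apply: avg_le => e.
apply: supabs_le => [|j _]; first by rewrite addr_ge0 ?supabs_ge0.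
rewrite /diff signed_sumB (le_trans (ler_normB _ _)) // lerD //.
  apply: (le_supabs R J [set: J]
    (fun j => signed_sum R n e (fun i => g j (X i p.1)))).
  by rewrite inE.
apply: (le_supabs R J [set: J]
  (fun j => signed_sum R n e (fun i => g j (X i p.2)))).
by rewrite inE.
Qed.

Lemma symmetrization :
  Ereal P (fun w => supabs R J [set: J]
    (fun j => \sum_(i < n) (g j (X i w) - Ereal P (g j \o X i)))) <=
  2 * Ereal P (fun w => rademacher R n J [set: J] (fun j i => g j (X i w))).
Proof. exact: le_trans Ereal_supabs_le_copy Ereal_copy_le_rademacher. Qed.

End FiniteClass.
End Symmetrization.

(** * Maximal inequality for a finite class *)

Lemma not_trace_full_above d (Xs : measurableType d) (R : realType)
    (F : set (Xs -> R)) (V : R) (J : finType) (f : J -> Xs -> R)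
    (n : nat) (x : 'I_n -> Xs) (S : seq ('I_n * R)) :
  VC_subgraph_dim_le F V -> (forall j, F (f j)) -> uniq S -> V < (size S)%:R ->
  ~ trace_full J _ (above R J n (fun j i => f j (x i))) [set: J] S.
Proof.
move=> FV Ff Su VS full.
pose h (q : 'I_n * R) : Xs * R := (x q.1, q.2).
(* Sample points may coincide, but shattering isolates each element of [S], so no two of them have
   the same image. *)
have hinj : {in S &, injective h}.
  move=> q q' qS q'S /= [xq tq]; apply: contrapT => qq'.
  have [j _ jS] := full (pred1 q).
  have := jS q qS; have := jS q' q'S.
  by rewrite /above /= xq tq => ->; rewrite eqxx; case: eqP => // /esym.
apply: (FV (map h S)); rewrite ?map_inj_in_uniq ?size_map // => A.
have [j _ jS] := full (fun q => `[< A (h q) >]).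
exists (f j) => // _ /mapP[q qS ->].
by have := jS q qS; rewrite /above /= => ->; split=> [/asboolP|/asboolP].
Qed.

(** Jensen's inequality for the square root, from its tangent at [Ereal P W]. *)
Lemma Ereal_le_sqrt d (T : measurableType d) (R : realType) (P : probability T R)
    (g W : T -> R) (c : R) :
  bounded_measurable d T R g -> bounded_measurable d T R W -> 0 <= c ->
  (forall w, 0 <= W w) -> (forall w, g w <= c * Num.sqrt (W w)) ->
  0 < Ereal P W -> Ereal P g <= c * Num.sqrt (Ereal P W).
Proof.
move=> bg bW c0 W0 gW EW0; set q := Num.sqrt (Ereal P W).
have q0 : 0 < q by rewrite sqrtr_gt0.
have q2 : q ^+ 2 = Ereal P W by rewrite sqr_sqrtr // ltW.
have b1 : bounded_measurable d T R (fun w => W w + q ^+ 2).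
  exact/bounded_measurableD/bounded_measurable_cst.
apply: (@le_trans _ _ (Ereal P (fun w => c / (2 * q) * (W w + q ^+ 2)))).
  apply: Ereal_le => // [|w]; first exact: bounded_measurableZ.
  rewrite (le_trans (gW w)) // -mulrA ler_wpM2l // mulrC ler_pdivlMr ?mulr_gt0 //.
  have := sqr_ge0 (Num.sqrt (W w) - q).
  by rewrite sqrrB sqr_sqrtr //; lra.
rewrite ErealZ // ErealD //; last exact: bounded_measurable_cst.
rewrite (Ereal_cst d T R P (q ^+ 2)) -q2 le_eqVlt; apply/orP; left.
by apply/eqP; field; exact: lt0r_neq0.
Qed.

Lemma Lsig_ge (R : realType) (sigma : R) : 0 < sigma <= 1 -> 9 <= Lsig sigma.
Proof.
move=> /andP[s0 s1]; have : 0 <= ln (1 / sigma ^+ 2).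
  by rewrite ln_ge0 // ler_pdivlMr ?exprn_gt0 // mul1r expr_le1 // ltW.
by rewrite /Lsig; lra.
Qed.

Section FiniteClassBound.
Context d d' (T : measurableType d) (Xs : measurableType d') (R : realType).
Variables (P : probability T R) (n : nat) (X : 'I_n -> T -> Xs).
Variables (F : set (Xs -> R)) (V sigma : R) (J : finType) (f : J -> Xs -> R).
Hypothesis n0 : (0 < n)%N.
Hypothesis mX : forall i, measurable_fun setT (X i).
Hypothesis indepX : mutually_independent P X.
Hypothesis mF : forall f, F f -> measurable_fun setT f.
Hypothesis F1 : forall f, F f -> forall x, -1 <= f x <= 1.
Hypothesis V1 : 1 <= V.
Hypothesis FV : VC_subgraph_dim_le F V.
Hypothesis sigma01 : 0 < sigma <= 1.
Hypothesis Fsigma : forall f, F f ->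
  n%:R^-1 * \sum_(i < n) Ereal P (fun w => f (X i w) ^+ 2) <= sigma ^+ 2.
Hypothesis Ff : forall j, F (f j).

Let L := Lsig sigma.
Let m w := supabs R J [set: J] (fun j => \sum_(i < n) f j (X i w) ^+ 2).
Let W w := V * (m w * (L - 1) + n%:R * sigma ^+ 2).
Let half_sq j x := f j x ^+ 2 / 2.

Let bf j : bounded_measurable d' Xs R (f j).
Proof.
split; first exact: mF; exists 1 => x.
by rewrite ler_norml; exact: F1.
Qed.

Let bhalf j : bounded_measurable d' Xs R (half_sq j).
Proof.
apply: bounded_measurableM; last exact: bounded_measurable_cst.
by under eq_fun do rewrite expr2; exact: bounded_measurableM.
Qed.

Let bsq j i : bounded_measurable d T R (fun w => f j (X i w) ^+ 2).
Proof.
under eq_fun do rewrite expr2.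
have bfX := bounded_measurable_comp _ _ _ _ _ _ _ (mX i) (bf j).
by apply: bounded_measurableM; exact: bfX.
Qed.

Let bm : bounded_measurable d T R m.
Proof. by apply: bounded_measurable_supabs => j; exact: bounded_measurable_sum. Qed.

Let bmL : bounded_measurable d T R (fun w => m w * (L - 1)).
Proof. by apply: bounded_measurableM => //; exact: bounded_measurable_cst. Qed.

Let bW : bounded_measurable d T R W.
Proof.
by apply/bounded_measurableZ/bounded_measurableD => //; exact: bounded_measurable_cst.
Qed.

Let EW : Ereal P W = V * (Ereal P m * (L - 1) + n%:R * sigma ^+ 2).
Proof.
rewrite ErealZ; last by apply: bounded_measurableD => //; exact: bounded_measurable_cst.
rewrite ErealD //; last exact: bounded_measurable_cst.
rewrite (Ereal_cst d T R P (n%:R * sigma ^+ 2)); congr (V * (_ + _)).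
under eq_fun do rewrite mulrC.
by rewrite ErealZ // mulrC.
Qed.

Let m_ge0 w : 0 <= m w. Proof. exact: supabs_ge0. Qed.

Let Em_ge0 : 0 <= Ereal P m.
Proof.
rewrite -(Ereal_cst d T R P 0); apply: Ereal_le => //.
exact: bounded_measurable_cst.
Qed.

Let nsigma_gt0 : 0 < n%:R * sigma ^+ 2.
Proof. by rewrite mulr_gt0 ?ltr0n // exprn_gt0 //; case/andP: sigma01. Qed.

Let L1_ge0 : 0 <= L - 1.
Proof. by have := Lsig_ge R sigma sigma01; rewrite -/L; lra. Qed.

Let W_ge0 w : 0 <= W w.
Proof.
apply: mulr_ge0; first exact: le_trans V1.
by apply: addr_ge0; [exact: mulr_ge0 | exact: ltW].
Qed.

Let EW_gt0 : 0 < Ereal P W.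
Proof.
rewrite EW; apply: mulr_gt0; first exact: lt_le_trans V1.
by apply: ltr_wpDl => //; exact: mulr_ge0.
Qed.

Let norm_f j x : `|f j x| <= 1.
Proof. by rewrite ler_norml; exact: F1. Qed.

(** Stated for a general contraction [v] because it serves for both [f] and [half_sq];
    symmetrization doubles [237 / 100]. *)
Let rademacher_bound (v : J -> Xs -> R) :
  (forall j, bounded_measurable d' Xs R (v j)) ->
  (forall j x, `|v j x| <= `|f j x|) ->
  (forall j j' x, `|v j x - v j' x| <= `|f j x - f j' x|) ->
  Ereal P (fun w => supabs R J [set: J]
    (fun j => \sum_(i < n) (v j (X i w) - Ereal P (v j \o X i)))) <=
  474 / 100 * Num.sqrt (Ereal P W).
Proof.
move=> bv vf vfB; apply: le_trans (symmetrization _ _ _ _ _ _ _ _ mX indepX J v bv) _.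
have -> : 474 / 100 = 2 * (237 / 100) :> R by lra.
rewrite -mulrA ler_pM2l //; apply: Ereal_le_sqrt => // [|w].
  exact: bounded_measurable_rademacher.
apply: (rademacher_le_variance R J n (fun j i => f j (X i w))
  (fun j i => v j (X i w)) V sigma n0) => //.
- by move=> j i; exact: F1.
- move=> S uS VS.
  exact: (not_trace_full_above _ _ _ F V J f n (X ^~ w) S FV Ff uS VS).
- by case/andP: sigma01.
Qed.

(** Twice the centred sum of [half_sq] is the centred sum of squares, and the means left over total
    at most [n * sigma ^ 2] by [Fsigma]. *)
Let Ereal_m_le : Ereal P m <=
  2 * (474 / 100 * Num.sqrt (Ereal P W)) + n%:R * sigma ^+ 2.
Proof.
have half_norm j x : `|half_sq j x| <= `|f j x|.
  rewrite /half_sq normrM normrX (ger0_norm (_ : 0 <= 2^-1)) // expr2 -mulrA.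
  by rewrite ler_piMr //; have := norm_f j x; lra.
have half_normB j j' x : `|half_sq j x - half_sq j' x| <= `|f j x - f j' x|.
  have -> : half_sq j x - half_sq j' x = (f j x - f j' x) * ((f j x + f j' x) / 2).
    by rewrite /half_sq; field.
  rewrite normrM ler_piMr // normrM (ger0_norm (_ : 0 <= 2^-1)) //.
  by have := ler_normD (f j x) (f j' x); have := norm_f j x; have := norm_f j' x; lra.
have := rademacher_bound half_sq bhalf half_norm half_normB.
set D := fun w => supabs _ _ _ _ => ED.
have bD : bounded_measurable d T R D.
  apply: bounded_measurable_supabs => j; apply: bounded_measurable_sum => i.
  apply: bounded_measurableB; last exact: bounded_measurable_cst.
  exact: (bounded_measurable_comp _ _ _ _ _ _ _ (mX i) (bhalf j)).
have b2D : bounded_measurable d T R (fun w => 2 * D w) by exact: bounded_measurableZ.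
have bcst := bounded_measurable_cst d T R (n%:R * sigma ^+ 2).
apply: (@le_trans _ _ (Ereal P (fun w => 2 * D w + n%:R * sigma ^+ 2))); last first.
  rewrite ErealD // ErealZ // (Ereal_cst d T R P (n%:R * sigma ^+ 2)).
  by rewrite lerD2r ler_pM2l.
apply: Ereal_le => // [|w]; first exact: bounded_measurableD.
apply: supabs_le => [|j _].
  by apply: addr_ge0; [apply: mulr_ge0 => //; exact: supabs_ge0 | exact: ltW].
have Ehalf i : Ereal P (half_sq j \o X i) = Ereal P (fun w => f j (X i w) ^+ 2) / 2.
  rewrite -[RHS]mulrC -ErealZ //; congr Ereal; apply/funext => w'.
  by rewrite /= /half_sq mulrC.
rewrite ger0_norm ?sumr_ge0 // => [|i _]; last exact: sqr_ge0.
have -> : \sum_(i < n) f j (X i w) ^+ 2 =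
    2 * \sum_(i < n) (half_sq j (X i w) - Ereal P (half_sq j \o X i)) +
    \sum_(i < n) Ereal P (fun w => f j (X i w) ^+ 2).
  rewrite mulr_sumr -big_split /=; apply: eq_bigr => i _.
  by rewrite Ehalf /half_sq; field.
apply: lerD.
  rewrite ler_pM2l // (le_trans (ler_norm _)) //.
  apply: (le_supabs R J [set: J] (fun j => \sum_(i < n)
    (half_sq j (X i w) - Ereal P (half_sq j \o X i)))).
  by rewrite inE.
by have := Fsigma (f j) (Ff j); rewrite ler_pdivrMl ?ltr0n.
Qed.

Lemma finite_class_bound :
  Ereal P (fun w => supabs R J [set: J]
    (fun j => \sum_(i < n) (f j (X i w) - Ereal P (f j \o X i)))) <=
  474 / 100 * Num.sqrt (n%:R * V * sigma ^+ 2 * Lsig sigma) + 90 * V * Lsig sigma.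
Proof.
apply: le_trans (rademacher_bound f bf _ _) _ => //.
set q := Num.sqrt (Ereal P W); rewrite -/L.
have V0 : 0 < V by exact: lt_le_trans V1.
have L0 : 0 < L by have := Lsig_ge R sigma sigma01; rewrite -/L; lra.
have q0 : 0 <= q by exact: sqrtr_ge0.
have A20 : 0 <= n%:R * V * sigma ^+ 2 * L.
  by rewrite mulr_ge0 ?(ltW L0) // mulrAC mulr_ge0 ?(ltW nsigma_gt0) // ltW.
set A := Num.sqrt _; have A0 : 0 <= A by exact: sqrtr_ge0.
have A2 : A ^+ 2 = n%:R * V * sigma ^+ 2 * L by rewrite sqr_sqrtr.
pose b := 948 / 100 * V * L; have VL0 : 0 < V * L by exact: mulr_gt0.
(* After [Ereal_m_le] the terms in [sigma ^ 2] add up to exactly [A ^ 2]: the last summand in [EW]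
   restores the 1 subtracted from [L]. *)
have q2 : q ^+ 2 <= A ^+ 2 + b * q.
  rewrite /q sqr_sqrtr ?(ltW EW_gt0) // -/q EW A2 /b.
  have Em := Ereal_m_le; rewrite -/q in Em.
  have := ler_wpM2l (mulr_ge0 (ltW V0) L1_ge0) Em.
  have : 0 <= V * q by rewrite mulr_ge0 // ltW.
  by lra.
have b0 : 0 <= b by rewrite /b; lra.
have qAb : q <= A + b.
  rewrite leNgt; apply/negP => Abq.
  have : (A + b) * (A + 0) < q * (q - b).
    have [->|AN0] := eqVneq A 0.
      by rewrite add0r addr0 mulr0; apply: mulr_gt0; lra.
    have Ap : 0 < A by rewrite lt_neqAle eq_sym AN0.
    by apply: ltr_pM; lra.
  have : 0 <= A * b by exact: mulr_ge0.
  by rewrite addr0 mulrBr mulrDl -!expr2; lra.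
by rewrite /b in qAb; lra.
Qed.

End FiniteClassBound.

(** * From finite classes to countable ones *)

(** For the degenerate cases: the supremum over an empty class is [-oo], and without observations it
    is at most 0. *)
Lemma integral_le0 d (T : measurableType d) (R : realType)
    (mu : {measure set T -> \bar R}) (h : T -> \bar R) :
  (forall w, h w <= 0)%E -> (\int[mu]_w h w <= 0)%E.
Proof.
move=> h0; under eq_integral do rewrite -[h _]oppeK.
rewrite integral_ge0N => [|w _]; last by rewrite oppe_ge0.
by rewrite oppe_le0 integral_ge0 // => w _; rewrite oppe_ge0.
Qed.

Section RunningSup.
Variables (R : realType) (a : nat -> R).

Let running_sup K : \bar R := (supabs R 'I_K.+1 [set: 'I_K.+1] (fun k => a k))%:E.

Lemma nondecreasing_running_sup : nondecreasing_seq running_sup.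
Proof.
move=> K K' KK'; rewrite lee_fin; apply: supabs_le => [|k _].
  exact: supabs_ge0.
have kK : (k < K'.+1)%N by rewrite (leq_trans (ltn_ord k)).
apply: (le_supabs R _ [set: 'I_K'.+1] (fun k => a k) (Ordinal kK)).
by rewrite inE.
Qed.

(** Presents the supremum as an increasing limit of finite maxima, ready for monotone
    convergence. *)
Lemma ereal_sup_range_norm :
  ereal_sup (range (fun k => `|a k|%:E)) = limn running_sup.
Proof.
rewrite (cvg_lim _ (ereal_nondecreasing_cvgn nondecreasing_running_sup)) //.
apply/eqP; rewrite eq_le; apply/andP; split; apply: ge_ereal_sup => _ [K _ <-].
  apply: (@le_trans _ _ (running_sup K)); last by apply: ereal_sup_ubound; exists K.
  rewrite lee_fin; apply: (le_supabs R _ [set: 'I_K.+1] (fun k => a k) ord_max).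
  by rewrite inE.
have [k _ kmax] := @arg_maxP _ _ 'I_K.+1 ord0 xpredT (fun k => `|a k|) isT.
apply: (@le_trans _ _ `|a k|%:E); last by apply: ereal_sup_ubound; exists (k : nat).
by rewrite lee_fin; apply: supabs_le => // k' _; exact: kmax.
Qed.

End RunningSup.

Theorem theorem2 (d d' : measure_display) (T : measurableType d)
  (Xs : measurableType d') (R : realType) (P : probability T R) (n : nat)
  (X : 'I_n -> T -> Xs) (F : set (Xs -> R)) (V sigma : R) :
  (forall i, measurable_fun setT (X i)) ->
  mutually_independent P X ->
  countable F ->
  (forall f, F f -> measurable_fun setT f) ->
  (forall f, F f -> forall x, -1 <= f x <= 1) ->
  1 <= V ->
  VC_subgraph_dim_le F V ->
  0 < sigma <= 1 ->
  (forall f, F f ->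
     n%:R^-1 * \sum_(i < n) Ereal P (fun w => f (X i w) ^+ 2) <= sigma ^+ 2) ->
  (\int[P]_w Zsup P X F w <=
     (474 / 100 * Num.sqrt (n%:R * V * sigma ^+ 2 * Lsig sigma)
      + 90 * V * Lsig sigma)%:E)%E.
Proof.
move=> mX indepX cF mF F1 V1 FV s01 Fs.
have L0 : 0 <= Lsig sigma by have := Lsig_ge R sigma s01; lra.
have bound0 : 0 <= 474 / 100 * Num.sqrt (n%:R * V * sigma ^+ 2 * Lsig sigma)
    + 90 * V * Lsig sigma.
  apply: addr_ge0; first by rewrite mulr_ge0 ?sqrtr_ge0.
  by apply: mulr_ge0 => //; apply: mulr_ge0 => //; exact: le_trans V1.
have Z0 : (forall w, Zsup P X F w <= 0)%E -> (\int[P]_w Zsup P X F w <=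
    (474 / 100 * Num.sqrt (n%:R * V * sigma ^+ 2 * Lsig sigma)
      + 90 * V * Lsig sigma)%:E)%E.
  by move=> /(integral_le0 _ _ _ P)/le_trans; apply; rewrite lee_fin.
have [n0|n0] := posnP n.
  apply: Z0 => w; apply: ge_ereal_sup => _ [f _ <-].
  by rewrite big1 ?normr0 // => i _; have := ltn_ord i; rewrite [X in (_ < X)%N]n0.
(* A nonempty countable class is enumerated by a sequence, possibly with repetitions. *)
have [F0|/surjfunPex[phi Fphi]] := pfcard_geP cF.
  by apply: Z0 => w; rewrite /Zsup F0 image_set0 ereal_sup0 leNye.
have Fk k : F (phi k) by rewrite Fphi; exists k.
pose a w k := \sum_(i < n) (phi k (X i w) - Ereal P (phi k \o X i)).
have ZE w : Zsup P X F w =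
    limn (fun K => (supabs R 'I_K.+1 [set: 'I_K.+1] (fun k => a w k))%:E).
  by rewrite -ereal_sup_range_norm /Zsup Fphi image_comp.
have bphi k : bounded_measurable d' Xs R (phi k).
  split; first exact/mF/Fk.
  by exists 1 => x; rewrite ler_norml; exact: F1.
have bs K : bounded_measurable d T R
    (fun w => supabs R 'I_K.+1 [set: 'I_K.+1] (fun k => a w k)).
  apply: bounded_measurable_supabs => k; apply: bounded_measurable_sum => i.
  apply: bounded_measurableB; last exact: bounded_measurable_cst.
  exact: (bounded_measurable_comp _ _ _ _ _ _ _ (mX i) (bphi k)).
under eq_integral do rewrite ZE.
have mono (w : T) : nondecreasing_seq
    (fun K => (supabs R 'I_K.+1 [set: 'I_K.+1] (fun k => a w k))%:E).
  exact: nondecreasing_running_sup.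
rewrite monotone_convergence //; last 2 first.
- by move=> K; apply/measurable_EFinP; exact: (bs K).1.
- by move=> K w _; rewrite lee_fin supabs_ge0.
(* The bound for the first [K + 1] functions is uniform in [K]. *)
apply: lime_le.
  apply: ereal_nondecreasing_is_cvgn => K K' KK'; apply: ge0_le_integral => //.
  - by move=> w _; rewrite lee_fin supabs_ge0.
  - by apply/measurable_EFinP; exact: (bs K).1.
  - by apply/measurable_EFinP; exact: (bs K').1.
  - by move=> w _; exact: mono.
apply: nearW => K; rewrite -EFin_Ereal // lee_fin.
exact: (finite_class_bound _ _ _ _ _ P n X F V sigma 'I_K.+1 (fun k => phi k)).
Qed.
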